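(* Let $\mathbb{Z}_2\wr\mathbb{Z}$ be the lamplighter group and let $\mathfrak{i}(n)=n$ for $n\in\mathbb{N}$. Then $\mathbb{Z}_2\wr\mathbb{Z}\in\mathcal{B}_{\mathfrak{i}}$. Moreover, for any $f\in\mathfrak{F}$ with $f\prec\mathfrak{i}$, $\mathbb{Z}_2\wr\mathbb{Z}\notin\mathcal{B}_f$.
   Context: All groups considered are finitely generated and infinite. $\mathbb{N}$ is the set of positive integers and $\mathbb{R}^{+}$ the set of non-negative reals. The lamplighter group is the (restricted) wreath product $\mathbb{Z}_2\wr\mathbb{Z}$ of the cyclic group of order 2 and the infinite cyclic group; it has the presentation $\langle a,t \mid a^2,\ [t^iat^{-i},t^jat^{-j}]\ (i,j\in\mathbb{Z})\rangle$. Notation. For a finite generating set $A \subseteq G$ of a group $G$, put $S = A \cup A^{-1}$. $d_A(g_1,g_2)$ denotes the distance between $g_1,g_2\in G$ in the Cayley graph $\Gamma(G,A)$. $\pi : S^* \to G$ is the canonical map sending a word to the group element it represents. Regular relations. For a finite alphabet $\Sigma$ and a padding symbol $\diamond \notin \Sigma$, the convolution $w_1 \otimes w_2$ of $w_1,w_2\in\Sigma^*$ is the string of length $\max\{|w_1|,|w_2|\}$ over $(\Sigma\cup\{\diamond\})^2$ whose $k$th symbol is $(\sigma_1,\sigma_2)$, where $\sigma_i$ is the $k$th symbol of $w_i$ if $k \leqslant |w_i|$ and $\diamond$ otherwise. A binary relation $R \subseteq \Sigma^*\times\Sigma^*$ is regular if $\{w_1\otimes w_2 : (w_1,w_2)\in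 R\}$ is a regular language (accepted by a finite automaton over $(\Sigma\cup\{\diamond\})^2\setminus\{(\diamond,\diamond)\}$). Cayley automatic representation. A Cayley automatic representation of $G$ (with respect to $A$) is a bijection $\psi: L \to G$, where $L\subseteq S^*$ is a regular language, such that for every $a\in A$ the relation $\{(\psi^{-1}(g),\psi^{-1}(ga)) : g\in G\}\subseteq L\times L$ is regular. $G$ is Cayley automatic if it has such a representation. Functions. $\mathfrak{F}$ is the set of all functions $f:[Q,+\infty)\to\mathbb{R}^{+}$, where $[Q,+\infty)\subseteq\mathbb{N}$ is the set of all integers $\geqslant Q$ for some $Q\in\mathbb{N}$ (depending on $f$), with $f(n)\leqslant f(n+1)$ for all $n\in\mathrm{dom}\, f$. For $f,h\in\mathfrak{F}$, write $h\preceq f$ if there exist positive integers $K,M,N$ such that $[N,+\infty)\subseteq \mathrm{dom}\,h\cap\mathrm{dom}\,f$ and $h(n)\leqslant K f(Mn)$ for every integer $n\geqslant N$. Write $h\asymp f$ if $h\preceq f$ and $f\preceq h$; write $h\prec f$ if $h\preceq f$ and not $h\asymp f$. The class $\mathcal{B}_f$. For $f\in\mathfrak{F}$, $\mathcal{B}_f$ is the class of all Cayley automatic groups $G$ for which there exist (for a chosen finite generating set $A$; the property does not depend on this choice) a regular language $L\subseteq S^*$ and a Cayley automatic representation $\psi: L\to G$ such that the function $h(n)=\max\{d_A(\pi(w),\psi(w)) : w\in L,\ |w|\leqslant n\}$ (defined for all $n$ for which $L$ contains a word of length at most $n$) satisfies $h\preceq f$. *)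

(* Defs.v *)
(* MathComp, with finmap and the classical sets and reals of MathComp-Analysis. *)
From HB Require Import structures.
From mathcomp Require Import all_boot all_order all_algebra.
From mathcomp Require Import finmap.
From mathcomp Require Import boolp classical_sets functions reals.

Set Implicit Arguments.
Unset Strict Implicit.
Unset Printing Implicit Defensive.

Import Order.TTheory GRing.Theory Num.Theory.

Local Open Scope classical_set_scope.
Local Open Scope fset_scope.

Record dfa (Sigma : finType) := DFA {
  dfa_state : finType;
  dfa_start : dfa_state;
  dfa_step : dfa_state -> Sigma -> dfa_state;
  dfa_final : pred dfa_state }.

Definition dfa_accepts (Sigma : finType) (M : dfa Sigma) (w : seq Sigma) : bool :=
  dfa_final (foldl (@dfa_step _ M) (dfa_start M) w).

Definition regular (Sigma : finType) (L : set (seq Sigma)) : Prop :=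
  exists M : dfa Sigma, L = [set w | dfa_accepts M w].

(* [None] is the padding symbol. *)
Definition padded (Sigma : finType) : finType :=
  {x : option Sigma * option Sigma | x != (None, None)}.

Definition convolution (T : Type) (u v : seq T) : seq (option T * option T) :=
  [seq (onth u k, onth v k) | k <- iota 0 (maxn (size u) (size v))].

Definition regular_rel (Sigma : finType) (R : seq Sigma -> seq Sigma -> Prop) :
    Prop :=
  regular [set x : seq (padded Sigma) |
    exists u v, R u v /\ [seq val c | c <- x] = convolution u v].

Section CayleyGraph.
Local Open Scope group_scope.
Variables (G : groupType) (A : {fset G}).

Definition sym_gen : {fset G} := A `|` [fset a^-1 | a in A].

(* Words are over the finite alphabet [sym_gen], a subset of [G]. *)
Definition word_val (w : seq sym_gen) : G := \prod_(s <- w) val s.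

Definition generates : Prop := forall g : G, exists w, word_val w = g.

Definition cayley_edge : rel G := fun g h => g^-1 * h \in sym_gen.

Definition walk (g h : G) (n : nat) : Prop :=
  exists p : seq G, [/\ path cayley_edge g p, last g p = h & size p = n].

(* Takes the junk value 0 when no walk exists, which does not happen if [A]
   generates [G]. *)
Definition cayley_dist (g h : G) : nat :=
  xget 0 [set n | walk g h n /\ forall m, walk g h m -> n <= m].

(* A bijection from the language [L] to [G] is encoded as a function defined on
   all words, whose values outside [L] are irrelevant. *)
Record cayley_rep := CayleyRep {
  rep_lang : set (seq sym_gen);
  rep_map :> seq sym_gen -> G;
  rep_regular : regular rep_lang;
  rep_bij : set_bij rep_lang [set: G] rep_map;
  rep_automatic : forall a, a \in A ->
    regular_rel (fun u v => exists g, [/\ rep_lang u, rep_lang v,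
                                       rep_map u = g & rep_map v = g * a]) }.

Variable psi : cayley_rep.

Definition has_word_upto (n : nat) : Prop :=
  exists2 w, rep_lang psi w & size w <= n.

Definition deviation (n : nat) : nat :=
  \max_(k < n.+1) \max_(w : k.-tuple sym_gen | `[< rep_lang psi w >])
    cayley_dist (word_val w) (psi w).

Lemma deviation_domain_nonempty : exists n, (0 < n) && `[< has_word_upto n >].
Proof.
have [_ _ surj] := rep_bij psi.
have [w Lw _] : (rep_map psi @` rep_lang psi)%classic 1 by apply: surj.
by exists (size w).+1; apply/andP; split=> //; apply/asboolP; exists w.
Qed.

Definition deviation_start : nat := ex_minn deviation_domain_nonempty.

Lemma deviation_start_gt0 : 0 < deviation_start.
Proof. by rewrite /deviation_start; case: ex_minnP => n /andP[]. Qed.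

Lemma deviation_startP n :
  0 < n -> deviation_start <= n <-> has_word_upto n.
Proof.
rewrite /deviation_start; case: ex_minnP => m /andP[m0 /asboolP[w Lw wm]] minm.
move=> n0; split=> [mn|wn]; first by exists w => //; apply: leq_trans mn.
by apply: minm; rewrite n0; apply/asboolP.
Qed.

Lemma deviation_leS n : deviation n <= deviation n.+1.
Proof. by rewrite /deviation [leqRHS]big_ord_recr /= leq_maxl. Qed.

End CayleyGraph.

Section Growth.
Local Open Scope ring_scope.
Variable R : realType.

(* A function on the integers [>= growth_start]; the values of [growth_fun]
   below [growth_start] are irrelevant. *)
Record growth := Growth {
  growth_start : nat;
  growth_fun :> nat -> R;
  growth_start_gt0 : (0 < growth_start)%N;
  growth_ge0 : forall n, (growth_start <= n)%N -> 0 <= growth_fun n;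
  growth_leS : forall n, (growth_start <= n)%N ->
    growth_fun n <= growth_fun n.+1 }.

Definition preceq (h f : growth) : Prop :=
  exists K M N : nat, [/\ (0 < K)%N, (0 < M)%N, (0 < N)%N,
    forall n, (N <= n)%N -> (growth_start h <= n)%N /\ (growth_start f <= n)%N &
    forall n, (N <= n)%N -> h n <= K%:R * f (M * n)%N].

Definition asymp (h f : growth) : Prop := preceq h f /\ preceq f h.

Definition prec (h f : growth) : Prop := preceq h f /\ ~ asymp h f.

Definition growth_id : growth :=
  @Growth 1 (fun n => n%:R) isT (fun n _ => ler0n R n)
    (fun n _ => etrans (ler_nat R n n.+1) (leqnSn n)).

Definition growth_deviation (G : groupType) (A : {fset G})
    (psi : cayley_rep A) : growth :=
  @Growth (deviation_start psi) (fun n => (deviation psi n)%:R)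
    (deviation_start_gt0 psi) (fun n _ => ler0n R (deviation psi n))
    (fun n _ => etrans (ler_nat R _ _) (deviation_leS psi n)).

(* Membership of [G] in the class B_f, relative to the finite generating set
   [A] (whether it holds does not depend on this choice). *)
Definition in_class_B (G : groupType) (A : {fset G}) (f : growth) : Prop :=
  exists psi : cayley_rep A, preceq (growth_deviation psi) f.

End Growth.

(* [(f, b)] with [f : K -> H] finitely supported and [b : K]; the active group
   [K] acts on the base group by translations. *)
Definition wreath (H K : zmodType) : Type := {fsfun K -> H with 0%R} * K.

HB.instance Definition _ (H K : zmodType) := Choice.on (wreath H K).

Section Wreath.
Local Open Scope ring_scope.
Variables (H K : zmodType).
Implicit Types (x y z : wreath H K).

Definition wreath_one : wreath H K := ([fsfun], 0).

Definition wreath_mul x y : wreath H K :=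
  ([fsfun k in finsupp x.1 `|` [fset l + x.2 | l in finsupp y.1] =>
      x.1 k + y.1 (k - x.2)], x.2 + y.2).

Definition wreath_inv x : wreath H K :=
  ([fsfun k in [fset l - x.2 | l in finsupp x.1] => - x.1 (k + x.2)], - x.2).

Lemma wreath_mulE x y k : (wreath_mul x y).1 k = x.1 k + y.1 (k - x.2).
Proof.
rewrite fsfun_fun; case: ifP => // /negbT.
rewrite inE negb_or => /andP[/fsfun_dflt -> ny].
rewrite fsfun_dflt ?addr0//; apply: contra ny => yk.
by apply/imfsetP; exists (k - x.2) => //; rewrite subrK.
Qed.

Lemma wreath_invE x k : (wreath_inv x).1 k = - x.1 (k + x.2).
Proof.
rewrite fsfun_fun; case: ifP => // /negbT nx.
rewrite fsfun_dflt ?oppr0//; apply: contra nx => xk.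
by apply/imfsetP; exists (k + x.2) => //; rewrite addrK.
Qed.

Lemma wreathP x y : (forall k, x.1 k = y.1 k) -> x.2 = y.2 -> x = y.
Proof. by case: x y => [f b] [g c] /= fg ->; congr (_, _); apply/fsfunP. Qed.

Lemma wreath_mulA : associative wreath_mul.
Proof.
move=> x y z; apply: wreathP => [k|/=]; last by rewrite addrA.
by rewrite !wreath_mulE /= !addrA opprD addrA.
Qed.

Lemma wreath_mul1g : left_id wreath_one wreath_mul.
Proof.
move=> x; apply: wreathP => [k|/=]; last by rewrite add0r.
by rewrite wreath_mulE /= fsfun0E add0r subr0.
Qed.

Lemma wreath_mulg1 : right_id wreath_one wreath_mul.
Proof.
move=> x; apply: wreathP => [k|/=]; last by rewrite addr0.
by rewrite wreath_mulE /= fsfun0E addr0.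
Qed.

Lemma wreath_mulVg : left_inverse wreath_one wreath_inv wreath_mul.
Proof.
move=> x; apply: wreathP => [k|/=]; last by rewrite addNr.
by rewrite wreath_mulE wreath_invE /= opprK addNr fsfun0E.
Qed.

Lemma wreath_mulgV : right_inverse wreath_one wreath_inv wreath_mul.
Proof.
move=> x; apply: wreathP => [k|/=]; last by rewrite subrr.
by rewrite wreath_mulE wreath_invE /= subrK subrr fsfun0E.
Qed.

HB.instance Definition _ := isGroup.Build (wreath H K)
  wreath_mulA wreath_mul1g wreath_mulg1 wreath_mulVg wreath_mulgV.

End Wreath.

Definition lamplighter : groupType := wreath 'Z_2 int.

Section LamplighterGenerators.
Local Open Scope group_scope.

(* With the conventions above, [t ^ i * a * t ^ - i] is the function with value
   1 at [i] and 0 elsewhere. *)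
Definition lamp_a : lamplighter := ([fsfun k in [fset 0%R] => 1%R], 0%R).
Definition lamp_t : lamplighter := ([fsfun], 1%R).

Lemma lamplighter_generated : generates [fset lamp_a; lamp_t].
Proof.
set A := [fset lamp_a; lamp_t]; set P := fun g => exists w, @word_val _ A w = g.
have P1 : P 1 by exists [::]; rewrite /word_val big_nil.
have PM g h : P g -> P h -> P (g * h).
  by move=> [u <-] [v <-]; exists (u ++ v); rewrite /word_val big_cat.
have PS g : g \in sym_gen A -> P g.
  by move=> gS; exists [:: [` gS] ]; rewrite /word_val big_seq1.
have Pa : P lamp_a by apply: PS; apply/fsetUP; left; apply: fset21.
have Pt : P lamp_t by apply: PS; apply/fsetUP; left; apply: fset22.
have PtV : P lamp_t^-1.
  apply: PS; apply/fsetUP; right.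
  by apply: (in_imfset _ (fun g => g^-1)); apply: fset22.
pose T (b : int) : lamplighter := ([fsfun], b).
have TD b c : T b * T c = T (b + c)%R.
  by apply: wreathP => // k; rewrite wreath_mulE !fsfun0E addr0.
have tV : lamp_t^-1 = T (- 1)%R.
  by apply: wreathP => // k; rewrite wreath_invE !fsfun0E oppr0.
have PT b : P (T b).
  elim: b => [|n IH|n IH]; first exact: P1.
    by rewrite intS -TD; apply: (PM).
  by rewrite intS opprD -TD -tV; apply: (PM).
pose D (l : int) : lamplighter := T l * (lamp_a * T (- l)%R).
have PD l : P (D l) by apply: (PM) => //; apply: (PM).
have DE l k : (D l).1 k = (k == l)%:R%R.
  rewrite wreath_mulE fsfun0E add0r wreath_mulE fsfun0E addr0 fsfun_fun inE.
  by rewrite subr_eq0; case: eqP.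
have D2 l : (D l).2 = 0%R by rewrite /= add0r subrr.
have Z2 (c : 'Z_2) : c = 0%R \/ c = 1%R.
  by case: c => -[|[|//]] i; [left|right]; apply: val_inj.
have PF (s : seq int) (f : {fsfun int -> 'Z_2 with 0%R}) :
    (forall k, f k != 0%R -> k \in s) -> P (f, 0%R).
  elim: s f => [|l s IH] f fs.
    suff -> : (f, 0%R) = 1 :> lamplighter by [].
    apply: wreathP => //= k; rewrite fsfun0E; apply/eqP.
    by apply/negPn/negP => /fs.
  have [fl|fl] := eqVneq (f l) 0%R.
    apply: IH => k fk; have := fs k fk; rewrite inE => /orP[/eqP kl|//].
    by rewrite kl fl eqxx in fk.
  have fl1 : f l = 1%R by case: (Z2 (f l)) fl => -> //; rewrite eqxx.
  have -> : (f, 0%R) = D l * (D l * (f, 0%R)) :> lamplighter.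
    apply: wreathP; last by rewrite /= !add0r !subrr.
    move=> k; rewrite (wreath_mulE (D l)) D2 subr0.
    rewrite (wreath_mulE (D l)) D2 subr0 !DE /= addrA -natrD.
    case: (k == l); last by rewrite add0r.
    by rewrite (_ : 2%:R = 0)%R ?add0r //; apply: val_inj.
  apply: (PM) => //.
  have -> : D l * (f, 0%R) = ((D l * (f, 0%R)).1, 0%R) :> lamplighter.
    by apply: wreathP => //=; rewrite !add0r subrr.
  apply: IH => k; rewrite (wreath_mulE (D l)) D2 subr0 DE.
  have [->|kl] := eqVneq k l; first by rewrite fl1.
  by rewrite add0r => /fs; rewrite inE (negbTE kl).
case=> f b; suff -> : (f, b) = ((f, 0%R) : lamplighter) * T b :> lamplighter.
  apply: (PM) => //; apply: (PF (finsupp f)) => k.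
  by rewrite mem_finsupp.
apply: wreathP => [k|/=]; last by rewrite add0r.
by rewrite wreath_mulE fsfun0E addr0.
Qed.

End LamplighterGenerators.

(* Main.v *)
(* Upper bound: fold the integer line at the origin and write the lamps and the
   position of the lamplighter as a finite bit string over two letters of the
   alphabet.  Multiplying by a generator changes this string locally, and an
   element is at distance linear in the length of its string from 1.

   Lower bound: if (u, v) is in the relation of a generator, any pair of
   prefixes of u and v is completed by boundedly many letters to a pair of the
   relation, so u and v fellow-travel at distance O(h(n)), h the deviation.
   Hence every relation of length n is a product of relations of length
   O(h(Cn)).  For each N the lamplighter group has a central extension by Z/2 in
   which the lamps at k and k + N do not commute; relations much shorter than N
   hold in it, whereas [a, t^N a t^-N] = 1 fails.  So h(CN) is at least linear
   in N. *)

Require Import Defs.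
From mathcomp Require Import all_boot all_order all_algebra.
From mathcomp Require Import finmap.
From mathcomp Require Import boolp classical_sets functions reals.
From mathcomp Require Import zify.

Set Implicit Arguments.
Unset Strict Implicit.
Unset Printing Implicit Defensive.

Import Order.TTheory GRing.Theory Num.Theory.

(** Merges the bounds obtained for single generators, or for single lit lamps, into a common one. *)
Lemma uniform_bound (T : eqType) (s : seq T) (P : nat -> T -> Prop) :
  (forall m n x, m <= n -> P m x -> P n x) ->
  (forall x, x \in s -> exists n, P n x) ->
  exists n, forall x, x \in s -> P n x.
Proof.
move=> Pmono; elim: s => [|x s IH] Ps; first by exists 0.
have [|m Pm] := IH; first by move=> y ys; apply: Ps; rewrite inE ys orbT.
have [n Pn] := Ps x (mem_head _ _); exists (maxn m n) => y.
rewrite inE => /orP[/eqP->|/Pm]; first exact: Pmono (leq_maxr _ _) Pn.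
exact: Pmono (leq_maxl _ _).
Qed.

(** * Predicates on infinite sequences recognised by finite automata *)

(* [s] is the label sequence of an infinite run that is eventually in [F].
   Unlike for finite words, projection and composition need no care about the
   lengths of the components. *)
Definition sofic (X : finType) (P : (nat -> X) -> Prop) : Prop :=
  exists (Q : finType) (I : Q -> Prop) (T : Q -> Q -> Prop) (lab : Q -> X)
    (F : Q -> Prop), forall s, P s <->
  exists r : nat -> Q, [/\ I (r 0), forall k, T (r k) (r k.+1),
    forall k, lab (r k) = s k & exists K, forall k, K <= k -> F (r k)].

Lemma eq_sofic (X : finType) (P P' : (nat -> X) -> Prop) :
  (forall s, P s <-> P' s) -> sofic P -> sofic P'.
Proof. by move=> /predeqP->. Qed.

Lemma sofic_local (X : finType) (I : X -> Prop) (T : X -> X -> Prop)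
    (F : X -> Prop) :
  sofic (fun s => [/\ I (s 0), forall k, T (s k) (s k.+1) &
                      exists K, forall k, K <= k -> F (s k)]).
Proof.
exists X, I, T, id, F => s; split=> [[s0 sS sF]|[r [r0 rS rs rF]]].
  by exists s.
by have <- : r = s by apply/funext.
Qed.

(** The letter of [Y] is stored in the state, since labels are functions of states and [f] need not
    be injective. *)
Lemma sofic_preim (X Y : finType) (f : Y -> X) (P : (nat -> X) -> Prop) :
  sofic P -> sofic (fun s : nat -> Y => P (f \o s)).
Proof.
move=> [Q [I [T [lab [F PE]]]]].
exists (Q * Y)%type, (fun q => I q.1 /\ lab q.1 = f q.2),
  (fun q q' => T q.1 q'.1 /\ lab q'.1 = f q'.2), snd, (fun q => F q.1) => s.
rewrite PE; split=> [[r [r0 rS rs [K rF]]]|[r [[r0 rl0] rS rs [K rF]]]].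
  by exists (fun k => (r k, s k)); split=> //=; exists K.
exists (fun k => (r k).1); split=> //; last by exists K.
  by move=> k; case: (rS k).
by case=> [|k]; rewrite /= -rs //; case: (rS k).
Qed.

Lemma sofic_and (X : finType) (P P' : (nat -> X) -> Prop) :
  sofic P -> sofic P' -> sofic (fun s => P s /\ P' s).
Proof.
move=> [Q [I [T [lab [F PE]]]]] [Q' [I' [T' [lab' [F' PE']]]]].
exists (Q * Q')%type, (fun q => [/\ I q.1, I' q.2 & lab q.1 = lab' q.2]),
  (fun q q' => [/\ T q.1 q'.1, T' q.2 q'.2 & lab q'.1 = lab' q'.2]),
  (fun q => lab q.1), (fun q => F q.1 /\ F' q.2) => s; rewrite PE PE'.
split=> [[[r [r0 rS rs [K rF]]] [r' [r0' rS' rs' [K' rF']]]]|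
         [r [[r0 r0' rl0] rS rs [K rF]]]].
  exists (fun k => (r k, r' k)); split=> //=; first by rewrite rs rs'.
    by move=> k; rewrite rs rs'.
  exists (maxn K K') => k; rewrite geq_max => /andP[Kk K'k].
  by split; [apply: rF|apply: rF'].
split; [exists (fun k => (r k).1)|exists (fun k => (r k).2)]; split=> //.
- by move=> k; case: (rS k).
- by exists K => k /rF[].
- by move=> k; case: (rS k).
- by case=> [|k]; rewrite -rs //; case: (rS k).
- by exists K => k /rF[].
Qed.

(** It suffices to forget part of the label: the run itself still determines a witness [t]. *)
Lemma sofic_exists (X Y : finType) (P : (nat -> X * Y) -> Prop) :
  sofic P -> sofic (fun s => exists t, P (fun k => (s k, t k))).
Proof.
move=> [Q [I [T [lab [F PE]]]]].
exists Q, I, T, (fun q => (lab q).1), F => s; split.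
  move=> [t /PE[r [r0 rS rs rF]]]; exists r; split=> // k; by rewrite rs.
move=> [r [r0 rS rs rF]]; exists (fun k => (lab (r k)).2); apply/PE.
by exists r; split=> // k; rewrite -rs -surjective_pairing.
Qed.

(** A phase bit doubles each state: it shows one component of its label, then the other, and only
    then does the original run advance. *)
Lemma sofic_pairs (X : finType) (P : (nat -> X * X) -> Prop) :
  sofic P -> sofic (fun s => P (fun j => (s j.*2, s j.*2.+1))).
Proof.
move=> [Q [I [T [lab [F PE]]]]].
exists (Q * bool)%type, (fun q => I q.1 /\ q.2 = false),
  (fun q q' => q'.2 = ~~ q.2 /\ if q.2 then T q.1 q'.1 else q'.1 = q.1),
  (fun q => if q.2 then (lab q.1).2 else (lab q.1).1), (fun q => F q.1) => s.
rewrite PE; split=> [[r [r0 rS rs [K rF]]]|[r [[r0 b0] rS rs [K rF]]]].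
  exists (fun k => (r k./2, odd k)); split=> //=.
  - by move=> k; split=> //; rewrite uphalf_half; case: (odd k).
  - move=> k; rewrite rs /= -[in RHS](odd_double_half k).
    by case: (odd k).
  - by exists K.*2 => k Kk; apply: rF; rewrite -(doubleK K) half_leq.
have rb k : (r k).2 = odd k.
  by elim: k => //= k <-; case: (rS k).
have rd k : (r k.*2.+1).1 = (r k.*2).1.
  by case: (rS k.*2) => _; rewrite rb odd_double.
exists (fun k => (r k.*2).1); split=> //.
- by move=> k; case: (rS k.*2.+1) => _; rewrite rb /= odd_double /= rd.
- move=> k; rewrite -!rs !rb /= odd_double /= rd; exact: surjective_pairing.
- by exists K => k Kk; apply: rF; rewrite -addnn; apply: leq_trans (leq_addr _ _).
Qed.

(** Subset construction. A set of states is final if one of them starts a run labelled [None]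
    forever and eventually in [F]. *)
Lemma regular_sofic (Sigma : finType) (P : (nat -> option Sigma) -> Prop) :
  sofic P -> regular [set w | P (onth w)]%classic.
Proof.
move=> [Q [I [T [lab [F PE]]]]].
pose run s (X : {set Q}) := exists r : nat -> Q,
  [/\ r 0 \in X, forall k, T (r k) (r k.+1), forall k, lab (r k) = s k
    & exists K, forall k, K <= k -> F (r k)].
pose step (X : {set Q}) c :=
  [set q' | `[< exists q, [/\ q \in X, lab q = Some c & T q q'] >]].
pose M := @DFA Sigma {set Q} [set q | `[< I q >]] step
  (fun X => `[< run (fun=> None) X >]).
exists M; apply/predeqP => w /=; rewrite PE.
have -> : (exists r : nat -> Q, [/\ I (r 0), forall k, T (r k) (r k.+1),
    forall k, lab (r k) = onth w k & exists K, forall k, K <= k -> F (r k)])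
    = run (onth w) [set q | `[< I q >]].
  apply/propext; split=> -[r [r0 *]]; exists r; split=> //.
    by rewrite inE; apply/asboolP.
  by move: r0; rewrite inE => /asboolP.
rewrite /dfa_accepts /=; move: [set _ | _] => X; elim: w X => [|c w IH] X /=.
  have -> : @onth Sigma [::] = fun=> None by apply/funext; case.
  by split=> /asboolP.
rewrite -IH; split=> [[r [r0 rS rs [K rF]]]|[r [+ rS rs [K rF]]]].
  exists (r \o S); split=> //.
  - rewrite inE; apply/asboolP; exists (r 0); split=> //; exact: rs.
  - by move=> k; apply: rS.
  - by move=> k; rewrite /= rs.
  - by exists K => k Kk; apply: rF; apply: leqW.
rewrite inE => /asboolP[q [qX qc qr]].
exists (fun k => if k is k'.+1 then r k' else q); split=> //.
- by case.
- by case=> //= k; rewrite rs.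
- by exists K.+1; case.
Qed.

(** * Regular relations *)

Lemma onth_convolution (T : Type) (u v : seq T) k :
  onth (convolution u v) k =
    if k < maxn (size u) (size v) then Some (onth u k, onth v k) else None.
Proof.
rewrite /convolution onth_map; case: ltnP => k_lt.
  by rewrite onthE (nth_map 0) ?size_iota // nth_iota.
by rewrite onth_default ?size_iota.
Qed.

Definition unpad (Sigma : finType) (c : option (padded Sigma)) :
    option Sigma * option Sigma := if c is Some c' then val c' else (None, None).

Lemma convolution_onthP (Sigma : finType) (x : seq (padded Sigma))
    (u v : seq Sigma) :
  [seq val c | c <- x] = convolution u v <->
  forall k, unpad (onth x k) = (onth u k, onth v k).
Proof.
split=> [xE k|xE].
  have := onth_convolution u v k; rewrite -xE onth_map.
  case: ltnP => k_lt; first by case: (onth x k) => //= c [->].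
  move: k_lt; rewrite geq_max => /andP[ku kv].
  by case: (onth x k) => //= _; rewrite !onth_default.
apply: eq_from_onth => k; rewrite onth_convolution onth_map.
have := xE k; rewrite /unpad; case: (onth x k) => [c|] /= cE.
  case: ltnP => [_|]; first by congr Some.
  rewrite geq_max => /andP[ku kv]; move: cE; rewrite !onth_default // => cE.
  (* A letter past both words would be the padding pair, which [padded] excludes. *)
  by case: c cE => c /= + cE; rewrite cE eqxx.
case: ltnP => //; rewrite leq_max.
by rewrite -!onthTE; case: cE => <- <-.
Qed.

Lemma regular_rel_sofic (Sigma : finType) (R : seq Sigma -> seq Sigma -> Prop) :
  sofic (fun s : nat -> option Sigma * option Sigma =>
    exists u v, R u v /\ forall k, s k = (onth u k, onth v k)) ->
  regular_rel R.
Proof.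
move=> /(@sofic_preim _ (option (padded Sigma)) (@unpad Sigma)) /regular_sofic.
rewrite /regular_rel; congr (regular _); apply/predeqP => x /=.
by split=> -[u [v [Ruv xE]]]; exists u, v; split=> //; apply/convolution_onthP.
Qed.

Lemma onth_take (T : Type) (s : seq T) k i :
  onth (take k s) i = if i < k then onth s i else None.
Proof.
case: ltnP => ik; first by rewrite !onthE map_take nth_take.
by rewrite onth_default // size_take_min geq_min ik.
Qed.

(** A path without repeated states has at most as many edges as there are states. Its labels are
    taken from [x], so that a component that is blank throughout [x] stays blank in [z]. *)
Lemma dfa_shorten (Sigma : finType) (M : dfa Sigma) q (x : seq Sigma) :
  exists z, [/\ {subset z <= x}, size z <= #|dfa_state M| &
                foldl (@dfa_step _ M) q z = foldl (@dfa_step _ M) q x].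
Proof.
pose step := @dfa_step _ M; pose e q q' := has (fun c => step q c == q') x.
have labels p : forall q, path e q p -> exists z,
    [/\ {subset z <= x}, size z = size p & foldl step q z = last q p].
  elim: p => [|q1 p IH] q0 /=; first by exists [::].
  case/andP=> /hasP[c cx /eqP cq1] /IH[z [zx zp zE]].
  exists (c :: z); split=> /=; [|by rewrite zp|by rewrite cq1].
  by move=> d; rewrite inE => /orP[/eqP->|/zx].
have runs y : {subset y <= x} -> forall q,
    exists p, path e q p /\ last q p = foldl step q y.
  elim: y => [|c y IH] yx q0 /=; first by exists [::].
  have cx : c \in x by apply: yx; rewrite mem_head.
  have [|p [ep pE]] := IH _ (step q0 c).
    by move=> d dy; apply: yx; rewrite inE dy orbT.
  exists (step q0 c :: p); split=> //=; rewrite ep andbT.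
  by apply/hasP; exists c.
have [p [+ <-]] := runs x (fun _ => id) q.
case/shortenP=> p' /labels[z [zx zp <-]] up' _; exists z; split=> //.
rewrite zp; apply: leq_trans (max_card (mem (q :: p'))).
by rewrite (card_uniqP up').
Qed.

Lemma convolution_padded (Sigma : finType) (u v : seq Sigma) :
  exists x : seq (padded Sigma), [seq val c | c <- x] = convolution u v.
Proof.
exists (pmap insub (convolution u v)); rewrite (pmap_filter (insubK _)).
apply/all_filterP/allP => c /onthP[k]; rewrite onth_convolution.
case: ltnP => // k_lt [<-]; rewrite isSome_insub.
apply: contraL k_lt => /eqP[uk vk].
by rewrite -leqNgt geq_max -!onthNE uk vk.
Qed.

(* Reading the automaton of [R] up to the [k]th letters, an accepting state is
   still reachable, and hence reachable by few of the remaining letters. *)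
Lemma regular_rel_prefix (Sigma : finType) (R : seq Sigma -> seq Sigma -> Prop) :
  regular_rel R -> exists c, forall u v k, R u v -> exists p q,
    [/\ R (take k u ++ p) (take k v ++ q), size p <= c, size q <= c,
        size u <= k -> p = [::] & size v <= k -> q = [::]].
Proof.
move=> [M RM]; exists #|dfa_state M| => u v k Ruv.
have RMP x : dfa_accepts M x <->
    exists u v, R u v /\ [seq val c | c <- x] = convolution u v.
  by move/predeqP: RM => /(_ x)[? ?]; split.
have [x xE] := convolution_padded u v.
have Mx : dfa_accepts M x by apply/RMP; exists u, v.
move/convolution_onthP: xE => xE.
case: (leqP k (size x)) => [kx|/ltnW xk]; last first.
  have le_k : size u <= k /\ size v <= k.
    have := xE k; rewrite onth_default //= => -[/esym uk /esym vk].
    by rewrite -!onthNE uk vk.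
  by exists [::], [::]; rewrite !cats0 !take_oversize; case: le_k.
move: Mx; rewrite -{1}(cat_take_drop k x) /dfa_accepts foldl_cat.
set q := foldl _ _ (take k x).
have [z [zx zc <-]] := dfa_shorten q (drop k x).
rewrite /q -foldl_cat => /RMP[u' [v' [Ruv' /convolution_onthP xE']]].
have lt_k i : i < k -> onth u' i = onth u i /\ onth v' i = onth v i.
  move=> ik; have := xE' i; rewrite onth_cat size_takel // ik onth_take ik xE.
  by case.
have take_k (s s' : seq Sigma) : (forall i, i < k -> onth s' i = onth s i) ->
    s' = take k s ++ drop k s'.
  move=> eq_s; rewrite -{1}(cat_take_drop k s'); congr cat.
  by apply: eq_from_onth => i; rewrite !onth_take; case: ltnP => // /eq_s.
have size_z i : k + size z <= i -> onth u' i = None /\ onth v' i = None.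
  move=> zi; have := xE' i; rewrite onth_default /=; first by case.
  by rewrite size_cat size_takel.
(* A component that has ended by position [k] is [None] in every letter of [drop k x], hence in
   every letter of [z]. *)
have drop_z i : k <= i -> (size u <= k -> onth u' i = None) /\
                          (size v <= k -> onth v' i = None).
  move=> ki; have := xE' i; rewrite onth_cat size_takel // ltnNge ki /=.
  case zi: (onth z (i - k)) => [c|] /= cE'; last by case: cE' => <- <-.
  have /zx/onthP[j] : c \in z by apply/onthP; exists (i - k).
  rewrite onthE map_drop nth_drop -onthE => xj.
  have := xE (k + j); rewrite xj /= => /(etrans (esym cE'))[-> ->].
  split=> /leq_trans le_k; by rewrite onth_default // le_k // leq_addr.
exists (drop k u'), (drop k v'); rewrite -!take_k => [|i /lt_k[]|i /lt_k[]] //.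
have [zu zv] := size_z _ (leqnn _).
have none_size (s : seq Sigma) i : onth s i = None -> size s <= i.
  by rewrite -onthNE => ->.
split=> //.
- by rewrite size_drop leq_subLR (leq_trans (none_size _ _ zu)) // leq_add2l.
- by rewrite size_drop leq_subLR (leq_trans (none_size _ _ zv)) // leq_add2l.
- by move=> /(drop_z k (leqnn k)).1 /none_size /drop_oversize.
- by move=> /(drop_z k (leqnn k)).2 /none_size /drop_oversize.
Qed.

(** * Word metric *)

Section WordMetric.
Local Open Scope group_scope.
Variables (G : groupType) (A : {fset G}).
Local Notation S := (sym_gen A).

Lemma word_val_cat (u v : seq S) : word_val (u ++ v) = word_val u * word_val v.
Proof. by rewrite /word_val big_cat. Qed.

Lemma word_val_cons s (w : seq S) : word_val (s :: w) = val s * word_val w.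
Proof. by rewrite /word_val big_cons. Qed.

Lemma word_val_rcons (w : seq S) s : word_val (rcons w s) = word_val w * val s.
Proof. by rewrite -cats1 word_val_cat [word_val [:: s]]big_seq1. Qed.

(** An existence statement in place of a minimum: estimates are composed by concatenating words,
    away from the default value in [cayley_dist]. *)
Definition ball (n : nat) (g : G) : Prop :=
  exists2 w : seq S, word_val w = g & size w <= n.

Lemma ball_word (w : seq S) : ball (size w) (word_val w).
Proof. by exists w. Qed.

Lemma ball_leq m n g : m <= n -> ball m g -> ball n g.
Proof. by move=> mn [w wg wm]; exists w => //; apply: leq_trans mn. Qed.

Lemma ball1 n : ball n 1.
Proof. by exists [::]; rewrite // /word_val big_nil. Qed.

Lemma ballM m n g h : ball m g -> ball n h -> ball (m + n) (g * h).
Proof.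
move=> [u <- um] [v <- vn]; exists (u ++ v); first exact: word_val_cat.
by rewrite size_cat leq_add.
Qed.

Lemma ball_gen g : g \in S -> ball 1 g.
Proof. by move=> gS; exists [:: [` gS]%fset]; rewrite // /word_val big_seq1. Qed.

Lemma sym_genV g : g \in S -> g^-1 \in S.
Proof.
case/fsetUP => [gA|/imfsetP[h /= hA ->]]; apply/fsetUP; last by left; rewrite invgK.
by right; apply/imfsetP; exists g.
Qed.

Lemma ballV n g : ball n g -> ball n g^-1.
Proof.
suff ballVw (w : seq S) : ball (size w) (word_val w)^-1.
  by move=> [w <- wn]; apply: ball_leq wn _.
elim: w => [|s w IH]; first by rewrite /word_val big_nil invg1; apply: ball1.
rewrite word_val_cons invgM /= -addn1; apply: ballM => //.
exact/ball_gen/sym_genV/valP.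
Qed.

Lemma ballX m n g : ball m g -> ball (n * m) (g ^+ n).
Proof.
move=> mg; elim: n => [|n IH]; first exact: ball1.
by rewrite expgS mulSn; apply: ballM.
Qed.

Lemma walk_ball g h n : walk A g h n -> ball n (g^-1 * h).
Proof.
move=> [p [+ <- <-]] {h n}; elim: p g => [|h p IH] g /=.
  by rewrite mulVg => _; apply: ball1.
case/andP=> gh /IH hp; rewrite -[g^-1](mulgK h) -mulgA -add1n.
by apply: ballM hp; apply: ball_gen.
Qed.

Lemma ball_walk g h n : ball n (g^-1 * h) -> exists2 m, m <= n & walk A g h m.
Proof.
move=> [w wE wn]; exists (size w) => //; rewrite -(mulVKg g h) -wE {h wE n wn}.
elim: w g => [|s w IH] g; first by exists [::]; rewrite /word_val big_nil mulg1.
rewrite word_val_cons mulgA; have [p [gp lp sp]] := IH (g * val s).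
exists (g * val s :: p); split=> //=; last by rewrite sp.
by rewrite gp andbT /cayley_edge mulKg; apply: valP.
Qed.

(** Generation supplies a walk, so the minimum exists and the default value is not taken. *)
Lemma cayley_distP g h : generates A ->
  walk A g h (cayley_dist A g h) /\
  forall m, walk A g h m -> cayley_dist A g h <= m.
Proof.
move=> genA; rewrite /cayley_dist; case: xgetP => [n -> //|no_min].
have [w wE] := genA (g^-1 * h).
have [m0 _ wm0] : exists2 m, m <= size w & walk A g h m.
  by apply: ball_walk; exists w.
have exw : exists m, `[< walk A g h m >] by exists m0; apply/asboolP.
case: (ex_minnP exw) => m /asboolP gm min_m.
by case: (no_min m); split=> // k gk; apply/min_m/asboolP.
Qed.

Lemma ball_cayley_dist g h : generates A -> ball (cayley_dist A g h) (g^-1 * h).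
Proof. by case/(cayley_distP g h) => /walk_ball. Qed.

Lemma cayley_dist_leq g h n :
  generates A -> ball n (g^-1 * h) -> cayley_dist A g h <= n.
Proof.
by case/(cayley_distP g h) => _ min_d /ball_walk[m mn /min_d /leq_trans]; apply.
Qed.

Variable psi : cayley_rep A.

Lemma deviation_leq n m : generates A ->
  (forall w, rep_lang psi w -> size w <= n ->
     ball m ((word_val w)^-1 * psi w)) ->
  deviation psi n <= m.
Proof.
move=> genA ballw; apply/bigmax_leqP => k _; apply/bigmax_leqP => w /asboolP Lw.
by apply: cayley_dist_leq => //; apply: ballw; rewrite // size_tuple -ltnS.
Qed.

Lemma ball_deviation w n : generates A -> rep_lang psi w -> size w <= n ->
  ball (deviation psi n) ((word_val w)^-1 * psi w).
Proof.
move=> genA Lw wn; apply: ball_leq (ball_cayley_dist _ _ genA).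
rewrite /deviation (bigD1 (Ordinal (wn : size w < n.+1))) //=.
rewrite (bigD1 (in_tuple w)) /=; last exact/asboolP.
by rewrite -!maxnA leq_maxl.
Qed.

Lemma deviation_homo m n : m <= n -> deviation psi m <= deviation psi n.
Proof.
move/subnKC <-; elim: (n - m) => [|k IH]; first by rewrite addn0.
by rewrite addnS; apply: leq_trans IH (deviation_leS _ _).
Qed.

End WordMetric.

(** * Lifting words to a locally split central extension *)

Section CentralExtension.
Local Open Scope group_scope.
Variables (G : groupType) (A : {fset G}) (V : zmodType) (omega : G -> G -> V).
Local Notation S := (sym_gen A).
Hypothesis cocycle : forall x y z,
  (omega x y + omega (x * y) z = omega y z + omega x (y * z))%R.
Hypothesis omega1l : forall x, omega 1 x = 0%R.
Hypothesis omega1r : forall x, omega x 1 = 0%R.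

(** The product of the central extension of [G] by [V] with cocycle [omega]. *)
Definition ext_mul (p q : G * V) : G * V :=
  (p.1 * q.1, (p.2 + q.2 + omega p.1 q.1)%R).

(** A set-theoretic section, multiplicative exactly where [omega] vanishes. *)
Definition ext_lift (g : G) : G * V := (g, 0%R).

Definition ext_prod (w : seq S) : G * V :=
  foldl (fun p s => ext_mul p (ext_lift (val s))) (ext_lift 1) w.

Lemma ext_mulA : associative ext_mul.
Proof.
move=> [x a] [y b] [z c]; rewrite /ext_mul /= mulgA; congr (_, _).
by rewrite -!addrA -cocycle (addrCA c).
Qed.

Lemma ext_mulg1 p : ext_mul p (ext_lift 1) = p.
Proof. by case: p => x a; rewrite /ext_mul /= mulg1 omega1r !addr0. Qed.

Lemma ext_prod_rcons w s :
  ext_prod (rcons w s) = ext_mul (ext_prod w) (ext_lift (val s)).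
Proof. by rewrite /ext_prod foldl_rcons. Qed.

Lemma ext_prod_cat u v : ext_prod (u ++ v) = ext_mul (ext_prod u) (ext_prod v).
Proof.
elim/last_ind: v => [|v s IH]; first by rewrite cats0 ext_mulg1.
by rewrite -rcons_cat !ext_prod_rcons IH ext_mulA.
Qed.

Lemma ext_prod_fst w : (ext_prod w).1 = word_val w.
Proof.
elim/last_ind: w => [|w s IH]; first by rewrite /word_val big_nil.
by rewrite ext_prod_rcons word_val_rcons -IH.
Qed.

Variable D : nat.
Hypothesis omega_ball : forall x y, ball A D x -> ball A D y -> omega x y = 0%R.

Lemma ext_liftM x y : ball A D x -> ball A D y ->
  ext_mul (ext_lift x) (ext_lift y) = ext_lift (x * y).
Proof. by move=> Dx Dy; rewrite /ext_mul /= omega_ball // !addr0. Qed.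

Lemma ext_prod_takeS (w : seq S) k : exists g, [/\ ball A 1 g,
  word_val (take k.+1 w) = word_val (take k w) * g &
  ext_prod (take k.+1 w) = ext_mul (ext_prod (take k w)) (ext_lift g)].
Proof.
case: (ltnP k (size w)) => kw.
  case: w kw => [//|s w] kw; exists (val (nth s (s :: w) k)).
  rewrite (take_nth s kw) word_val_rcons ext_prod_rcons; split=> //.
  exact/ball_gen/valP.
exists 1; rewrite (take_oversize kw) (take_oversize (leqW kw)) mulg1 ext_mulg1.
by split=> //; apply: ball1.
Qed.

(** Let [d_k] be the difference of the prefixes of length [k], and [g], [h] the next letters. Then
    [d_k * h = g * d_(k+1)], and [D0 < D] puts all four factors into the ball where the section is
    multiplicative, so the identity lifts letter by letter. *)
Lemma ext_prod_fellow (u v : seq S) D0 : D0 < D ->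
  (forall k, ball A D0 ((word_val (take k u))^-1 * word_val (take k v))) ->
  ext_prod v = ext_mul (ext_prod u) (ext_lift ((word_val u)^-1 * word_val v)).
Proof.
move=> D0D uv; have D1 : 0 < D by apply: leq_trans D0D.
suff step k : ext_prod (take k v) = ext_mul (ext_prod (take k u))
    (ext_lift ((word_val (take k u))^-1 * word_val (take k v))).
  have := step (maxn (size u) (size v)).
  by rewrite !take_oversize ?leq_maxl ?leq_maxr.
elim: k => [|k IH]; first by rewrite !take0 mulVg ext_mulg1.
have [g [g1 ug ->]] := ext_prod_takeS u k.
have [h [h1 vh ->]] := ext_prod_takeS v k.
have D0k := ball_leq (ltnW D0D) (uv k); have D0k1 := ball_leq (ltnW D0D) (uv k.+1).
rewrite IH -!ext_mulA !ext_liftM //; [|exact: ball_leq g1|exact: ball_leq h1].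
by rewrite ug vh invgM -!mulgA mulVKg.
Qed.

Section Representation.
Variable psi : cayley_rep A.
Hypothesis genA : generates A.

Definition rep_edge (a : G) (u v : seq S) : Prop :=
  exists g, [/\ rep_lang psi u, rep_lang psi v, psi u = g & psi v = g * a].

Lemma rep_edgeP a u v : rep_edge a u v <->
  [/\ rep_lang psi u, rep_lang psi v & psi v = psi u * a].
Proof. by split=> [[g [Lu Lv -> ->]]|[Lu Lv uv]] //; exists (psi u). Qed.

Definition edge_completion (c : nat) (a : G) : Prop := forall u v k,
  rep_edge a u v -> exists p q,
    [/\ rep_edge a (take k u ++ p) (take k v ++ q), size p <= c, size q <= c,
        size u <= k -> p = [::] & size v <= k -> q = [::]].

Lemma rep_edge_completion :
  exists c, forall a, a \in A -> edge_completion c a.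
Proof.
apply: uniform_bound => [m n a mn am u v k /(am _ _ k)|a aA].
  move=> [p [q [? /leq_trans pm /leq_trans qm ? ?]]].
  by exists p, q; rewrite pm ?qm.
have [c ac] := regular_rel_prefix (rep_automatic psi aA).
by exists c => u v k /(ac _ _ k).
Qed.

Lemma rep_inj u v : rep_lang psi u -> rep_lang psi v -> psi u = psi v -> u = v.
Proof. by have [_ inj _] := rep_bij psi => Lu Lv; apply: inj; rewrite inE. Qed.

Lemma rep_surj g : exists2 w, rep_lang psi w & psi w = g.
Proof. by have [_ _ surj] := rep_bij psi; apply: surj. Qed.

Variable c : nat.
Hypothesis completion_c : forall a, a \in A -> edge_completion c a.

(** Cut both words at the length of one of them: that one needs no completion, and injectivity of
    [psi] identifies the completed other one with the original. *)
Lemma rep_edge_size a u v : a \in A -> rep_edge a u v ->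
  size u <= size v + c /\ size v <= size u + c.
Proof.
move=> aA uv; have /rep_edgeP[Lu Lv vE] := uv; split.
  have [p [q [/rep_edgeP[Lu' Lv' vE'] pc _ _ q0]]] := completion_c aA (size v) uv.
  move: Lv' vE'; rewrite q0 // cats0 take_size vE => _ /mulIg uu'.
  rewrite (rep_inj Lu Lu' uu') size_cat leq_add //.
  by rewrite size_take_min geq_minl.
have [p [q [/rep_edgeP[Lu' Lv' vE'] _ qc p0 _]]] := completion_c aA (size u) uv.
move: Lu' vE'; rewrite p0 // cats0 take_size => _; rewrite -vE => vv'.
rewrite -(rep_inj Lv' Lv vv') size_cat leq_add //.
by rewrite size_take_min geq_minl.
Qed.

(** Complete the prefixes to an edge and go from one to the other through it: each side costs a
    completion ([c]) and a deviation at length at most [l + c], and the edge itself costs 1. *)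
Lemma rep_edge_fellow a u v l k : a \in A -> rep_edge a u v ->
  size u <= l -> size v <= l ->
  ball A ((c + deviation psi (l + c)).*2.+1)
    ((word_val (take k u))^-1 * word_val (take k v)).
Proof.
move=> aA uv ul vl.
have [p [q [/rep_edgeP[Lu Lv vE] pc qc _ _]]] := completion_c aA k uv.
have size_l (w x : seq S) :
    size w <= l -> size x <= c -> size (take k w ++ x) <= l + c.
  move=> wl xc; rewrite size_cat leq_add //.
  by apply: leq_trans wl; rewrite size_take_min geq_minr.
have du := ball_deviation genA Lu (size_l _ _ ul pc).
have dv := ball_deviation genA Lv (size_l _ _ vl qc).
have a1 : ball A 1 a by apply: ball_gen; apply/fsetUP; left.
have := ballM (ball_leq pc (ball_word p)) (ballM du (ballM a1
  (ballM (ballV dv) (ballV (ball_leq qc (ball_word q)))))).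
rewrite !word_val_cat vE !invgM !invgK -!mulgA !mulVKg mulgV mulg1.
by apply: ball_leq; rewrite -addnn; lia.
Qed.

(** A lift of [psi w]: spell [w] in the extension, then lift the correction from [word_val w] to
    [psi w]. *)
Definition rep_section (w : seq S) : G * V :=
  ext_mul (ext_prod w) (ext_lift ((word_val w)^-1 * psi w)).

Variable l : nat.
Hypothesis D_big : (c + deviation psi (l + c)).*2.+1 < D.

(** Fellow travelling relates the two spelled parts; the remaining factors are short, so their lifts
    multiply as in [G]. *)
Lemma rep_section_edge a u v : a \in A -> rep_edge a u v ->
  size u <= l -> size v <= l ->
  rep_section v = ext_mul (rep_section u) (ext_lift a).
Proof.
move=> aA uv ul vl; have /rep_edgeP[Lu Lv vE] := uv.
have small_l w : rep_lang psi w -> size w <= l ->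
    ball A D ((word_val w)^-1 * psi w).
  move=> Lw wl.
  apply: ball_leq (ball_deviation genA Lw (leq_trans wl (leq_addr c l))).
  by move: D_big; rewrite -addnn; lia.
have fellow k := rep_edge_fellow k aA uv ul vl.
have uvD : ball A D ((word_val u)^-1 * word_val v).
  have := ball_leq (ltnW D_big) (fellow (maxn (size u) (size v))).
  by rewrite !take_oversize ?leq_maxl ?leq_maxr.
have aD : ball A D a.
  by apply: ball_leq (_ : 0 < D) _; [lia|apply: ball_gen; apply/fsetUP; left].
have [du dv] := (small_l _ Lu ul, small_l _ Lv vl).
rewrite /rep_section (ext_prod_fellow D_big fellow) -!ext_mulA !ext_liftM //.
by rewrite vE -!mulgA mulVKg.
Qed.

Variable u0 : seq S.
Hypothesis u0_lang : rep_lang psi u0.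
Hypothesis u0_val : psi u0 = 1.

(** Along the prefixes of [w] the representing word grows by at most [c] per letter, so every edge
    met stays within length [l]. *)
Lemma rep_section_word (w v : seq S) : (size u0 + c * size w <= l)%N ->
  rep_lang psi v -> psi v = word_val w ->
  (size v <= size u0 + c * size w)%N /\
  rep_section v = ext_mul (rep_section u0) (ext_prod w).
Proof.
elim/last_ind: w v => [|w s IH] v.
  move=> _ Lv; rewrite /word_val big_nil -u0_val => /(rep_inj Lv u0_lang)->.
  by rewrite muln0 addn0 ext_mulg1.
rewrite size_rcons mulnS word_val_rcons => wl Lv vE.
have [v' Lv' v'E] := rep_surj (word_val w).
have [|sv' v's] := IH v' _ Lv' v'E; first by lia.
rewrite ext_prod_rcons ext_mulA -v's.
have [sA|[a aA sE]] : val s \in A \/ exists2 a, a \in A & val s = a^-1.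
  by case/fsetUP: (valP s) => [|/imfsetP[a /= aA sE]]; [left|right; exists a].
  have edge : rep_edge (val s) v' v by apply/rep_edgeP; rewrite vE v'E.
  have [_ sv] := rep_edge_size sA edge.
  by split; [lia|apply: rep_section_edge => //; lia].
(* For an inverse letter the edge is traversed backwards, from [v] to [v']. *)
have edge : rep_edge a v v'.
  by apply/rep_edgeP; rewrite vE v'E sE mulgVK.
have [sv _] := rep_edge_size aA edge.
have aD : ball A D a.
  by apply: ball_leq (_ : 0 < D) _; [lia|apply: ball_gen; apply/fsetUP; left].
split; first by lia.
rewrite (rep_section_edge aA edge); [|lia|lia].
by rewrite sE -ext_mulA ext_liftM ?mulgV ?ext_mulg1 //; apply: ballV.
Qed.

(** Both products, after the same left factor [rep_section u0], equal the section at the word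
    representing the common value. So relations of bounded length hold in the extension. *)
Lemma ext_prod_eq (u v : seq S) n : (size u0 + c * n <= l)%N ->
  size u <= n -> size v <= n -> word_val u = word_val v ->
  ext_prod u = ext_prod v.
Proof.
move=> nl un vn uvE; have [w Lw wE] := rep_surj (word_val u).
have le_l x : x <= n -> (size u0 + c * x <= l)%N.
  by move=> xn; apply: leq_trans nl; rewrite leq_add2l leq_mul2l xn orbT.
have [_ eu] := rep_section_word (le_l _ un) Lw wE.
have [_ ev] := rep_section_word (le_l _ vn) Lw (etrans wE uvE).
(* The left factor lies over 1, where the cocycle vanishes; only its central part has to be
   cancelled. *)
have s1 : (rep_section u0).1 = 1.
  by rewrite /= ext_prod_fst u0_val mulVKg.
move: ev; rewrite eu /ext_mul s1 !omega1l !addr0 => -[_ /addrI uv2].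
by rewrite [LHS]surjective_pairing [RHS]surjective_pairing !ext_prod_fst uvE uv2.
Qed.

End Representation.
End CentralExtension.

(** * A central extension of the lamplighter group *)

Lemma lamp_aE k : lamp_a.1 k = ((k == 0)%:R)%R.
Proof. by rewrite fsfun_fun inE; case: eqP. Qed.

Lemma lamp_tX n : (lamp_t ^+ n)%g = (([fsfun], n%:Z%R) : lamplighter).
Proof.
elim: n => [//|n IH]; rewrite expgS IH; apply: wreathP => [l|/=]; last by lia.
by rewrite wreath_mulE !fsfun0E addr0.
Qed.

Section LampCocycle.
Local Open Scope ring_scope.
Variable N : nat.
Implicit Types x y z : lamplighter.

(* In the extension by this cocycle, lifts of the lamps at [k] and [k + N] do
   not commute. *)
Definition lamp_cocycle x y : 'Z_2 :=
  \sum_(k <- finsupp x.1) x.1 k * y.1 (k + N%:Z - x.2).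

Lemma lamp_cocycleE x y (D : {fset int}) : (finsupp x.1 `<=` D)%fset ->
  lamp_cocycle x y = \sum_(k <- D) x.1 k * y.1 (k + N%:Z - x.2).
Proof.
move=> xD; apply: big_fset_incl => // k _ kx.
by rewrite fsfun_dflt // mul0r.
Qed.

(** Over an index set [D] containing the support of [x] and the translated support of [y], the
    identity is distributivity term by term. *)
Lemma lamp_cocycleP x y z :
  lamp_cocycle x y + lamp_cocycle (x * y)%g z =
  lamp_cocycle y z + lamp_cocycle x (y * z)%g.
Proof.
pose Dx := finsupp x.1; pose Dy := [fset (l + x.2)%R | l in finsupp y.1]%fset.
pose D := (Dx `|` Dy)%fset.
have yE : lamp_cocycle y z = \sum_(k <- D)
    y.1 (k - x.2) * z.1 (k - x.2 + N%:Z - y.2).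
  transitivity (\sum_(k <- Dy) y.1 (k - x.2) * z.1 (k - x.2 + N%:Z - y.2)).
    rewrite eq_big_imfset /= ?big_map; last by move=> ? ? _ _ /addIr.
    by apply: eq_bigr => k _; rewrite addrK.
  apply: big_fset_incl; first exact: fsubsetUr.
  move=> k _ kD; rewrite (fsfun_dflt (k := k - x.2)) ?mul0r //.
  by apply: contra kD => ky; apply/imfsetP; exists (k - x.2); rewrite ?subrK.
have xyE : lamp_cocycle (x * y)%g z = \sum_(k <- D)
    (x.1 k + y.1 (k - x.2)) * z.1 (k + N%:Z - (x.2 + y.2)).
  rewrite (@lamp_cocycleE _ _ D); last exact: finsupp_sub.
  by apply: eq_bigr => k _; rewrite wreath_mulE.
rewrite xyE yE !(@lamp_cocycleE x _ D) ?fsubsetUl // -!big_split /=.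
apply: eq_bigr => k _; rewrite wreath_mulE.
have -> : k - x.2 + N%:Z - y.2 = k + N%:Z - (x.2 + y.2) by lia.
have -> : k + N%:Z - x.2 - y.2 = k + N%:Z - (x.2 + y.2) by lia.
by rewrite mulrDl mulrDr addrA addrC.
Qed.

Lemma lamp_cocycle1l x : lamp_cocycle 1%g x = 0.
Proof. by apply: big1 => k _; rewrite fsfun0E mul0r. Qed.

Lemma lamp_cocycle1r x : lamp_cocycle x 1%g = 0.
Proof. by apply: big1 => k _; rewrite fsfun0E mulr0. Qed.


(** A substitute for word length that is read off the lamps and the position; it is bounded linearly
    by word length. *)
Definition lamp_within (r : nat) x : Prop :=
  (forall k, x.1 k != 0 -> (absz k <= r)%N) /\ (absz x.2 <= r)%N.

Lemma lamp_withinM r r' x y :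
  lamp_within r x -> lamp_within r' y -> lamp_within (r + r')%N (x * y)%g.
Proof.
have absD (b c : int) : (absz b <= r -> absz c <= r' ->
  absz (b + c)%R <= r + r')%N by lia.
move=> [x1 x2] [y1 y2]; split=> [k|/=]; last exact: absD.
rewrite wreath_mulE; have [->|/x1 xk _] := eqVneq (x.1 k) 0.
  by rewrite add0r => /y1 /(absD _ _ x2); rewrite addrC subrK.
by rewrite (leq_trans xk) ?leq_addr.
Qed.

Lemma lamp_within_leq r r' x : (r <= r')%N -> lamp_within r x -> lamp_within r' x.
Proof. by move=> rr' [x1 x2]; split=> [k /x1|]; lia. Qed.

Lemma lamp_within_exists x : exists r, lamp_within r x.
Proof.
have [r rx] : exists r, forall k, k \in finsupp x.1 -> (absz k <= r)%N.
  apply: (@uniform_bound _ (finsupp x.1) (fun r k => (absz k <= r)%N)).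
    by move=> m n k; lia.
  by move=> k _; exists (absz k).
exists (maxn r (absz x.2)); split=> [k xk|]; last by lia.
by rewrite leq_max rx ?mem_finsupp.
Qed.

Lemma lamp_within_ball (A : {fset lamplighter}) :
  exists R, forall n x, ball A n x -> lamp_within (R * n)%N x.
Proof.
have [R RA] : exists R, forall s, s \in sym_gen A -> lamp_within R s.
  apply: (uniform_bound lamp_within_leq) => s _; exact: lamp_within_exists.
exists R => n x [w <- wn]; apply: (lamp_within_leq (leq_mul (leqnn R) wn)).
elim: w {wn} => [|s w IH].
  by rewrite /word_val big_nil; split=> // k; rewrite fsfun0E eqxx.
by rewrite word_val_cons mulnS; apply: lamp_withinM => //; apply/RA/valP.
Qed.

(** A nonzero term would need [k], [x.2] and [k + N - x.2] all of absolute value at most [r], hence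
    [N <= 3 * r]. *)
Lemma lamp_cocycle_within r x y : (3 * r < N)%N ->
  lamp_within r x -> lamp_within r y -> lamp_cocycle x y = 0.
Proof.
move=> rN [x1 x2] [y1 _]; apply: big1 => k _.
have [->|/x1 xk] := eqVneq (x.1 k) 0; first by rewrite mul0r.
have [->|/y1] := eqVneq (y.1 (k + N%:Z - x.2)) 0; first by rewrite mulr0.
by lia.
Qed.

Definition far_lamp : lamplighter :=
  (lamp_t ^+ N * (lamp_a * lamp_t^-1 ^+ N))%g.

Lemma far_lampE k : far_lamp.1 k = (k == N%:Z)%:R.
Proof.
rewrite /far_lamp lamp_tX expVgn lamp_tX !wreath_mulE wreath_invE !fsfun0E.
by rewrite add0r oppr0 addr0 lamp_aE subr_eq0.
Qed.

Lemma far_lamp_snd : far_lamp.2 = 0.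
Proof.
have expg_snd (x : lamplighter) n : (x ^+ n)%g.2 = x.2 *+ n.
  by elim: n => [//|n IH]; rewrite expgS mulrS -IH.
by rewrite /far_lamp /= !expg_snd /= mulNrn add0r subrr.
Qed.

Lemma lamp_far_commute : (lamp_a * far_lamp = far_lamp * lamp_a)%g.
Proof.
apply: wreathP => [k|]; last exact: addrC.
by rewrite !wreath_mulE far_lamp_snd !subr0 addrC.
Qed.

(** This is the commutator of the two lifts. In the first order the lamps at 0 and [N] meet; in the
    other, [lamp_a] would have to be lit at [2 * N]. *)
Lemma lamp_cocycle_far : (0 < N)%N ->
  lamp_cocycle lamp_a far_lamp - lamp_cocycle far_lamp lamp_a = 1.
Proof.
move=> N0; rewrite (@lamp_cocycleE lamp_a _ [fset 0]%fset); last first.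
  apply/fsubsetP => k; rewrite mem_finsupp lamp_aE inE.
  by case: (k == 0); rewrite ?eqxx.
rewrite big_seq_fset1 lamp_aE far_lampE eqxx add0r subr0 eqxx mulr1.
rewrite [X in _ - X]big1 ?subr0 // => k _.
rewrite lamp_aE far_lampE far_lamp_snd.
by have [->|_] := eqVneq k N; rewrite ?mul0r // [_ == 0]negbTE ?mulr0 //; lia.
Qed.

End LampCocycle.

(** * Linear lower bound for the deviation *)

Lemma deviation_lower (A : {fset lamplighter}) (psi : cayley_rep A) :
  generates A -> exists K, forall N, N <= K * (deviation psi (K * N + K)).+1.
Proof.
move=> genA; have [R RP] := lamp_within_ball A.
have [c cP] := rep_edge_completion psi; have [u0 Lu0 u0E] := rep_surj psi 1%g.
have [wa waE] := genA lamp_a; have [wt wtE] := genA lamp_t.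
(* The words for both sides of the commutation relation have length at most [e * (2 * N + 2)]. The
   representatives met along them have length at most [L N - c], and completing prefixes adds up to
   [c]. *)
pose e := size wa + size wt; pose L N := size u0 + c * (e * (2 * N + 2)) + c.
pose h N := deviation psi (L N).
have bound N : N <= 3 * (R * (c + h N).*2.+2).
  rewrite leqNgt; apply/negP => N_big.
  have ea : ball A e lamp_a.
    by rewrite -waE; apply: ball_leq (ball_word wa); apply: leq_addr.
  have et : ball A e lamp_t.
    by rewrite -wtE; apply: ball_leq (ball_word wt); apply: leq_addl.
  have [w wE ws] : ball A (N * e + (e + N * e)) (far_lamp N).
    by apply: ballM (ballX _ et) (ballM ea (ballX _ (ballV et))).
  have vanish x y : ball A (c + h N).*2.+2 x -> ball A (c + h N).*2.+2 y ->
      lamp_cocycle N x y = 0%R.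
    by move=> /RP x_in /RP y_in; apply: lamp_cocycle_within N_big x_in y_in.
  have := @ext_prod_eq _ A _ _ (lamp_cocycleP N) (lamp_cocycle1l N)
    (lamp_cocycle1r N) _ vanish psi genA c cP _ (leqnn _) u0 Lu0 u0E
    (wa ++ w) (w ++ wa) (e * (2 * N + 2)) (leqnn _).
  have small : size wa + size w <= e * (2 * N + 2).
    have : size wa <= e by apply: leq_addr.
    by move: ws; rewrite mulnDr mulnCA mulnC; nia.
  rewrite !size_cat [X in _ -> X <= _ -> _]addnC !word_val_cat waE wE.
  move=> /(_ small small (lamp_far_commute N)) /(congr1 snd).
  rewrite !(ext_prod_cat (lamp_cocycleP N) (lamp_cocycle1r N)).
  have N0 : 0 < N by apply: leq_ltn_trans N_big.
  (* The central parts of the two factors cancel, which leaves an equality of the two cocycle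
     values. *)
  rewrite /ext_mul /= !ext_prod_fst waE wE [X in (X + _)%R = _]addrC => /addrI.
  by move=> far_eq; have := lamp_cocycle_far N0; rewrite far_eq subrr.
(* The first summand serves [6 R (c + h + 1) <= 6 R (c + 1) (h + 1)], the second bounds the
   coefficients of [L N]. *)
pose K := 6 * R * (c + 1) + (size u0 + 2 * c * e + c); exists K => N.
apply: leq_trans (bound N) _.
have LK : L N <= K * N + K.
  have : 2 * c * e * N <= K * N by rewrite leq_mul2r /K; apply/orP; right; lia.
  by rewrite /L /K; lia.
have hK : h N <= deviation psi (K * N + K) by apply: deviation_homo.
have : 6 * R * (c + 1) <= K by apply: leq_addr.
move: (deviation _ _) hK => d hK K_big; rewrite -!muln2.
apply: (leq_trans _ (leq_mul K_big (leqnn _))).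
have : R * (c + h N + 1) <= R * ((c + 1) * d.+1) by rewrite leq_mul2l; nia.
by nia.
Qed.

(** * Word length in the lamplighter group *)

Section LampBall.
Variables (A : {fset lamplighter}) (e : nat).
Hypothesis ball_a : ball A e lamp_a.
Hypothesis ball_t : ball A e lamp_t.

Lemma lamp_aK : (lamp_a * lamp_a)%g = 1%g.
Proof.
apply: wreathP => [k|]; last exact: addr0.
by rewrite wreath_mulE subr0 lamp_aE fsfun0E; case: (k == 0%R); apply/val_inj.
Qed.

(** One sweep to the right: the last factor [a ^ b * t] sets the last lamp and steps past it, at
    cost [2 * e]. *)
Lemma ball_lamp_interval m (x : lamplighter) :
  (forall k, x.1 k != 0%R -> (0 <= k < m%:Z)%R) -> x.2 = m%:Z%R ->
  ball A (2 * e * m) x.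
Proof.
elim: m x => [|m IH] x x1 x2.
  rewrite (_ : x = 1%g); first exact: ball1.
  apply: wreathP => // k; rewrite fsfun0E; apply/eqP/negPn/negP => /x1.
  by lia.
pose b : bool := x.1 m%:Z%R != 0%R.
pose y : lamplighter := (x * lamp_t^-1 * lamp_a ^+ b)%g.
have -> : x = (y * (lamp_a ^+ b * lamp_t))%g.
  have aa : (lamp_a ^+ b * lamp_a ^+ b)%g = 1%g.
    by case: b {y}; rewrite ?expg1 ?lamp_aK // expg0 mulg1.
  by rewrite /y -!mulgA (mulgA _ _ lamp_t) aa mul1g mulVg mulg1.
rewrite mulnSr; apply: ballM; last first.
  rewrite mul2n -addnn; apply: ballM => //.
  by case: b {y} => //; apply: ball1.
have tVk k : (lamp_t^-1)%g.1 k = 0%R by rewrite wreath_invE fsfun0E oppr0.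
have x2' : (x * lamp_t^-1)%g.2 = m%:Z%R by rewrite /= x2; lia.
have yE k : y.1 k = (x.1 k + ((k == m%:Z) && b)%:R)%R.
  rewrite /y wreath_mulE x2' wreath_mulE tVk addr0 /b.
  case: (_ != _); last by rewrite expg0 fsfun0E andbF.
  by rewrite expg1 lamp_aE subr_eq0 andbT.
apply: IH => [k|]; last first.
  have -> : y.2 = ((x * lamp_t^-1)%g.2 + (lamp_a ^+ b)%g.2)%R by [].
  by rewrite x2' /b; case: (_ != _); rewrite addr0.
rewrite yE; have [->|km] := eqVneq k m%:Z%R.
  rewrite /b; case: (x.1 _) => -[|[|//]] i; rewrite -?val_eqE //=.
by rewrite addr0 => /x1; move: km; lia.
Qed.

(** Shifting by [t ^ m] on the left moves the lamps into [[0, 2m]], and [t ^ j] on the right brings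
    the lamplighter to [2m + 1], where a single sweep applies. The total is [e * (7m + 3)] at
    most. *)
Lemma ball_lamp_within m x : lamp_within m x -> ball A (7 * e * m.+1) x.
Proof.
move=> [x1 x2]; pose j := absz ((m + 1)%N%:Z - (x.2 : int))%R.
pose y : lamplighter := (lamp_t ^+ m * x * lamp_t ^+ j)%g.
have -> : x = (lamp_t ^- m * (y * lamp_t ^- j))%g by rewrite /y mulgK mulKg.
have shiftE (b : int) : absz b <= m ->
    (m%:Z + b + (absz ((m + 1)%N%:Z - b))%:Z = (2 * m).+1%:Z)%R by lia.
have shift_leq (b : int) : absz b <= m ->
    absz ((m + 1)%N%:Z - b)%R <= (2 * m).+1 by lia.
have jm : j <= (2 * m).+1 := shift_leq _ x2.
have ytE : ball A (2 * e * (2 * m).+1) y.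
  apply: ball_lamp_interval => [k|].
    rewrite /y !lamp_tX !wreath_mulE !fsfun0E add0r addr0 /= => /x1.
    by lia.
  by rewrite /y !lamp_tX /=; apply: shiftE.
have := ballM (ballV (ballX m ball_t)) (ballM ytE (ballV (ballX j ball_t))).
by apply: ball_leq; nia.
Qed.

End LampBall.

(** * The Cayley automatic representation *)

Definition cell : finType := ((bool * bool) * (bool * bool))%type.

(* Cell [j] shows the positions [j] and [Negz j = - 1 - j]: first whether the
   lamplighter stands there, then whether their lamps are lit. *)
Definition lamp_code (x : lamplighter) (j : nat) : cell :=
  ((x.2 == Posz j, x.2 == Negz j), (x.1 (Posz j) != 0%R, x.1 (Negz j) != 0%R)).

Lemma Z2_bool (y : 'Z_2) : y = (y != 0%R)%:R%R.
Proof. by case: y => -[|[|//]] i; apply/val_inj. Qed.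

Lemma lamp_code_inj x y : lamp_code x =1 lamp_code y -> x = y.
Proof.
move=> xy; apply: wreathP => [[k|k]|].
- by have [_ _ lit _] := xy k; rewrite (Z2_bool (x.1 _)) lit -Z2_bool.
- by have [_ _ _ lit] := xy k; rewrite (Z2_bool (x.1 _)) lit -Z2_bool.
case x2 : (x.2 : int) => [k|k].
  by have [+ _ _ _] := xy k; rewrite x2 eqxx => /esym/eqP.
by have [_ + _ _] := xy k; rewrite x2 eqxx => /esym/eqP.
Qed.

Definition int_cell (b : int) : nat := match b with Posz j => j | Negz j => j end.

Definition has_cursor (c : cell) : bool := c.1.1 || c.1.2.

Lemma has_cursor_code x k : has_cursor (lamp_code x k) = (int_cell x.2 == k).
Proof.
rewrite /has_cursor /=; case: (x.2 : int) => j /=.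
  by rewrite orbF.
by [].
Qed.

Definition blank_cell : cell := ((false, false), (false, false)).

Lemma lamp_code_blank x : exists K, forall k, K <= k -> lamp_code x k = blank_cell.
Proof.
have [r [x1 x2]] := lamp_within_exists x; exists r.+1 => k rk.
have lit (b : int) : r < absz b -> (x.1 b != 0%R) = false.
  by move=> rb; apply/negbTE/negP => /x1; lia.
have stand (b : int) : r < absz b -> (x.2 == b) = false.
  by move=> rb; apply/negbTE/eqP => xb; move: x2; rewrite xb; lia.
by rewrite /lamp_code !lit ?stand //; lia.
Qed.

Lemma lamp_code_surj (c : nat -> cell) n :
  (forall k, has_cursor (c k) = (n == k)) -> ~~ ((c n).1.1 && (c n).1.2) ->
  (exists K, forall k, K <= k -> c k = blank_cell) ->
  exists x, c =1 lamp_code x.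
Proof.
move=> cur_n one [K Kblank].
pose D := ([fset Posz j | j in iota 0 K] `|` [fset Negz j | j in iota 0 K])%fset.
pose lit (b : int) := match b with Posz j => (c j).2.1 | Negz j => (c j).2.2 end.
pose f : {fsfun int -> 'Z_2 with 0%R} := [fsfun k in D => (lit k)%:R%R].
have fE k : f k = (lit k)%:R%R.
  rewrite fsfun_fun; case: ifPn => //; apply: contraNeq => fk.
  have litk : lit k by case: (lit k) fk => //; rewrite eqxx.
  have lt_K j : (c j).2.1 || (c j).2.2 -> j \in iota 0 K.
    by rewrite mem_iota /= add0n ltnNge; apply: contraL => /Kblank->.
  apply/fsetUP; case: k litk {fk} => j /= cj; [left|right];
    apply/imfsetP; exists j => //=.
    by apply: lt_K; rewrite cj.
  by apply: lt_K; rewrite cj orbT.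
pose b := if (c n).1.1 then Posz n else Negz n.
exists (f, b) => k; rewrite /lamp_code /= !fE /= /b.
have b2 (y : bool) : ((y%:R : 'Z_2) != 0)%R = y by case: y.
rewrite !b2; have := cur_n k; have := cur_n n; rewrite eqxx; move: one.
have PN (i j : nat) : (Posz i == Negz j) = false by [].
have NP (i j : nat) : (Negz i == Posz j) = false by [].
have PP (i j : nat) : (Posz i == Posz j) = (i == j) by [].
have NN (i j : nat) : (Negz i == Negz j) = (i == j) by [].
have [<-|/negbTE nk] := eqVneq n k.
  by case: (c n) => [[[] []] [l l']] //= _ _ _; rewrite ?PN ?NP ?PP ?NN eqxx.
move=> _ _; case: (c k) => [[[] []] [l l']] //= _.
by case: ifP; rewrite ?PN ?NP ?PP ?NN nk.
Qed.

(** An auxiliary track records whether the lamplighter stands in an earlier cell. This makes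
    uniqueness of the cursor a local condition, and existence the condition that the track is
    eventually on. *)
Lemma sofic_lamp_code : sofic (fun c => exists x, c =1 lamp_code x).
Proof.
pose ok (s : nat -> cell * bool) := [/\ (s 0).2 = false,
  (forall k, (s k.+1).2 = (s k).2 || has_cursor (s k).1 /\
     ~~ ((s k).2 && has_cursor (s k).1) /\ ~~ ((s k).1.1.1 && (s k).1.1.2)) &
  exists K, forall k, K <= k -> (s k).1 = blank_cell /\ (s k).2].
apply: (@eq_sofic _ (fun c => exists t, ok (fun k => (c k, t k)))); last first.
  apply: sofic_exists; apply: (sofic_local (fun o : cell * bool => o.2 = false)
   (fun o o' => o'.2 = o.2 || has_cursor o.1 /\
     ~~ (o.2 && has_cursor o.1) /\ ~~ (o.1.1.1 && o.1.1.2))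
   (fun o => o.1 = blank_cell /\ o.2)).
move=> c; split=> [[t [/= t0 tS [K Kt]]]|[x cx]]; last first.
  exists (fun k => int_cell x.2 < k); split=> //= [k|].
    rewrite cx has_cursor_code ltnS leq_eqVlt orbC; do !split=> //=.
      by case: ltngtP.
    by case: (x.2 =P Posz k) => // ->.
  have [K Kx] := lamp_code_blank x.
  exists (maxn K (int_cell x.2).+1) => k; rewrite geq_max cx => /andP[/Kx-> ->].
  by [].
have ext : exists k, t k.+1 by exists K; case: (Kt K.+1).
have t_up j i : t j -> t (j + i).
  by move=> tj; elim: i => [|i IH]; rewrite ?addn0 // addnS (tS _).1 IH.
(* The cursor is in the last cell before the track switches on. *)
case: (ex_minnP ext) => n tn min_n.
have tE k : t k = (n < k).
  case: ltnP => nk; first by rewrite -(subnKC nk) t_up.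
  case: k nk => [|k] nk; first by rewrite t0.
  by apply/negbTE/negP => /min_n; rewrite leqNgt nk.
apply: (@lamp_code_surj _ n) => [k||].
- have [tk [+ _]] := tS k; move: tk; rewrite !tE ltnS leq_eqVlt orbC.
  by case: ltngtP => //=; case: (has_cursor _).
- by have [_ []] := tS n.
- by exists K => k /Kt[].
Qed.

(** * Right multiplication on codes *)

Definition lamp_step (g : lamplighter) (s : nat -> cell * cell) : Prop :=
  exists x : lamplighter, forall k, s k = (lamp_code x k, lamp_code (x * g)%g k).

(** The first track is a code by [sofic_lamp_code], so it is enough that it determines the second
    track by local rules. *)
Lemma sofic_lamp_step_local g (I : cell * cell -> Prop)
    (T : cell * cell -> cell * cell -> Prop) :
  (forall (x : lamplighter) (c : nat -> cell),
     c =1 lamp_code (x * g)%g <->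
     I (lamp_code x 0, c 0) /\
     forall k, T (lamp_code x k, c k) (lamp_code x k.+1, c k.+1)) ->
  sofic (lamp_step g).
Proof.
move=> gE; apply: (@eq_sofic _ (fun s : nat -> cell * cell =>
    (exists x, fst \o s =1 lamp_code x) /\
    [/\ I (s 0), forall k, T (s k) (s k.+1) & exists K, forall k, K <= k -> True])).
  move=> s; split=> [[[x xE] [s0 sT _]]|[x xE]].
    exists x; have sE k : s k = (lamp_code x k, (s k).2).
      by rewrite -xE -surjective_pairing.
    have /gE xgE : I (lamp_code x 0, (s 0).2) /\ forall k,
        T (lamp_code x k, (s k).2) (lamp_code x k.+1, (s k.+1).2).
      by rewrite -sE; split=> // k; rewrite -!sE.
    by move=> k; rewrite sE (xgE k).
  have [i t] := (gE x _).1 (fun k => erefl (lamp_code (x * g)%g k)).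
  split; first by exists x => k; rewrite /= xE.
  by split=> [|k|]; [rewrite xE|rewrite !xE|exists 0].
apply: sofic_and (sofic_local _ _ (fun=> True)).
exact: sofic_preim sofic_lamp_code.
Qed.

Lemma sofic_lamp_step1 : sofic (lamp_step 1%g).
Proof.
apply: (@sofic_lamp_step_local _ (fun=> True) (fun o _ => o.2 = o.1)) => x c.
by rewrite mulg1; split=> [cx|[_ cx] k]; [split=> // k; rewrite -cx|exact: cx].
Qed.

(** The cursor bits of a cell are added to its lamp bits. *)
Lemma sofic_lamp_step_a : sofic (lamp_step lamp_a).
Proof.
apply: (@sofic_lamp_step_local _ (fun=> True) (fun o _ => o.2 =
  (o.1.1, (o.1.2.1 (+) o.1.1.1, o.1.2.2 (+) o.1.1.2)))) => x c.
suff xaE k : lamp_code (x * lamp_a)%g k = ((lamp_code x k).1,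
    ((lamp_code x k).2.1 (+) (lamp_code x k).1.1,
     (lamp_code x k).2.2 (+) (lamp_code x k).1.2)).
  by split=> [cx|[_ cx] k]; [split=> // k; rewrite cx xaE|rewrite xaE; exact: cx].
have lit (y : 'Z_2) (b : bool) : (y + b%:R != 0)%R = (y != 0%R) (+) b.
  by case: y b => -[|[|//]] i []; rewrite -!val_eqE.
have x2 : (x * lamp_a)%g.2 = x.2 := addr0 _.
rewrite /lamp_code x2 !wreath_mulE !lamp_aE !lit !subr_eq0.
by rewrite (eq_sym (Posz k)) (eq_sym (Negz k)).
Qed.

(** The cursor moves one cell outwards on the nonnegative half and one cell inwards on the negative
    half; the initial condition is the passage from -1 to 0 inside cell 0. *)
Lemma sofic_lamp_step_t : sofic (lamp_step lamp_t).
Proof.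
apply: (@sofic_lamp_step_local _ (fun o => o.2.1.1 = o.1.1.2)
  (fun o o' => [/\ o'.2.1.1 = o.1.1.1, o.2.1.2 = o'.1.1.2 & o.2.2 = o.1.2])).
move=> x c.
have b0 (b : int) : ((b + 1)%R == Posz 0) = (b == Negz 0) by lia.
have bP (b : int) k : ((b + 1)%R == Posz k.+1) = (b == Posz k) by lia.
have bN (b : int) k : ((b + 1)%R == Negz k) = (b == Negz k.+1) by lia.
have lamps k : (x * lamp_t)%g.1 k = x.1 k by rewrite wreath_mulE fsfun0E addr0.
split=> [cx|[c0 cT] k].
  split=> [|k]; rewrite !cx /lamp_code /= ?lamps; first exact: b0.
  by split; [exact: bP|exact: bN|].
have c1 : (c k).1.1 = ((x * lamp_t)%g.2 == Posz k).
  case: k => [|k]; first by rewrite c0 /= -b0.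
  by have [-> _ _] := cT k; rewrite /= -bP.
have [_ c2 c3] := cT k; rewrite /lamp_code !lamps -c1 -[RHS]/(_, (_, _)).
rewrite [LHS]surjective_pairing c3 [(c k).1]surjective_pairing c2.
by congr (_, _, _); rewrite /= -bN.
Qed.

Lemma sofic_lamp_stepV g : sofic (lamp_step g) -> sofic (lamp_step g^-1%g).
Proof.
move=> /(@sofic_preim _ _ (fun o : cell * cell => (o.2, o.1))).
apply: eq_sofic => s; split=> -[x xE].
  exists (x * g)%g => k; rewrite mulgK; have [<- <-] := xE k.
  exact: surjective_pairing.
by exists (x * g^-1)%g => k; rewrite mulgVK /= xE.
Qed.

(** Composition through an existential middle track, on which the two elements agree because codes
    are injective. *)
Lemma sofic_lamp_stepM g h :
  sofic (lamp_step g) -> sofic (lamp_step h) -> sofic (lamp_step (g * h)%g).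
Proof.
move=> /(@sofic_preim _ _ (fun o : cell * cell * cell => (o.1.1, o.2))) Sg.
move=> /(@sofic_preim _ _ (fun o : cell * cell * cell => (o.2, o.1.2))) Sh.
apply: eq_sofic (sofic_exists (sofic_and Sg Sh)) => s.
split=> [[t [[x xE] [y yE]]]|[x xE]].
  have yx : y = (x * g)%g.
    by apply: lamp_code_inj => k; have [_ <-] := xE k; have [<- _] := yE k.
  rewrite {}yx in yE.
  exists x => k; rewrite mulgA; have [<- _] := xE k; have [_ <-] := yE k.
  exact: surjective_pairing.
exists (lamp_code (x * g)%g); split; [exists x|exists (x * g)%g] => k /=.
  by rewrite xE.
by rewrite -mulgA xE.
Qed.

Lemma sofic_lamp_step g : sofic (lamp_step g).
Proof.
have [w <-] := lamplighter_generated g; elim: w => [|s w IH].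
  by rewrite /word_val big_nil; apply: sofic_lamp_step1.
rewrite word_val_cons; apply: sofic_lamp_stepM => //.
have gen h : h \in [fset lamp_a; lamp_t]%fset -> sofic (lamp_step h).
  by case/fset2P=> ->; [exact: sofic_lamp_step_a|exact: sofic_lamp_step_t].
case/fsetUP: (valP s) => [/gen //|/imfsetP[h /= /gen sh ->]].
exact: sofic_lamp_stepV.
Qed.

(** * Words over two letters as bit sequences *)

Definition pairs (X : Type) (s : nat -> X) (j : nat) : X * X :=
  (s j.*2, s j.*2.+1).

Definition unpairs (X : Type) (s : nat -> X * X) (k : nat) : X :=
  if odd k then (s k./2).2 else (s k./2).1.

Lemma unpairsK (X : Type) (s : nat -> X * X) : pairs (unpairs s) =1 s.
Proof.
move=> j; rewrite /pairs /unpairs /= odd_double doubleK uphalf_double.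
by rewrite -surjective_pairing.
Qed.

Lemma pairs_inj (X : Type) (s s' : nat -> X) : pairs s =1 pairs s' -> s =1 s'.
Proof.
move=> ss' k; rewrite -(odd_double_half k); have [e o] := ss' k./2.
by case: (odd k).
Qed.

Section BinaryWords.
Variables (Sigma : finType) (p q : Sigma).
Hypothesis p_neq_q : p <> q.

Let pq : p != q. Proof. exact/eqP. Qed.

(* Words over [{p, q}] without trailing [p], viewed as infinite sequences;
   they stand for finitely supported bit sequences, [q] being the bit 1. *)
Definition trimmed_step (o o' : option Sigma) : Prop :=
  [\/ o = Some q, o = Some p /\ o' <> None | o = None /\ o' = None].

Definition trimmed (s : nat -> option Sigma) : Prop :=
  (forall k, trimmed_step (s k) (s k.+1)) /\
  exists K, forall k, K <= k -> s k = None.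

Definition bits (s : nat -> option Sigma) (k : nat) : bool := s k == Some q.

Lemma trimmed_none s k : trimmed s -> s k = None -> forall j, k <= j -> s j = None.
Proof.
move=> [sS _] sk j /subnKC<-; elim: (j - k) => [|i IH]; first by rewrite addn0.
by rewrite addnS; case: (sS (k + i)); rewrite IH // => -[].
Qed.

(** Without a later [q], each [p] forces another [p], contradicting the eventual [None]. *)
Lemma trimmed_some s k : trimmed s -> s k <> None -> exists2 j, k <= j & bits s j.
Proof.
move=> [sS [K sK]] sk; apply: contrapT => no_q.
have sp i : s (k + i) = Some p.
  have not_q j : k <= j -> s j <> Some q.
    by move=> kj /eqP sj; apply: no_q; exists j.
  elim: i => [|i IH]; rewrite ?addn0 ?addnS.
    by case: (sS k) => [/(not_q _ (leqnn k))|[]|[]].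
  have kki : k <= (k + i).+1 by rewrite -addnS leq_addr.
  case: (sS (k + i)) => [|[_ sn]|[]]; rewrite ?IH //.
    by case=> /eqP; rewrite (negbTE pq).
  by case: (sS (k + i).+1) => [/(not_q _ kki)|[]|[/sn]].
by have := sp K; rewrite sK ?leq_addl.
Qed.

(** Bits do not distinguish [p] from [None], but a trimmed sequence ends right after its last
    [q]. *)
Lemma trimmed_inj s s' : trimmed s -> trimmed s' -> bits s =1 bits s' -> s =1 s'.
Proof.
suff none s1 s2 k : trimmed s1 -> trimmed s2 -> bits s1 =1 bits s2 ->
    s1 k = None -> s2 k = None.
  have pqF : (Some p == Some q) = false.
    by apply/negbTE; apply: contra pq => /eqP[->].
  move=> ts ts' ss' k; have letter s1 : trimmed s1 -> s1 k <> None ->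
      s1 k = Some (if bits s1 k then q else p).
    case=> /(_ k) s1k _ s1n; rewrite /bits.
    by case: s1k => [->|[-> _]|[/s1n]] //; rewrite ?eqxx ?pqF.
  have [sk|sk] := pselect (s k = None).
    by rewrite sk (none s s' k).
  rewrite (letter s) // (letter s') // ?ss' // => s'k; apply: sk.
  exact: none s'k.
move=> t1 t2 b12 s1k; apply: contrapT => /(trimmed_some t2)[j kj].
by rewrite -b12 /bits (trimmed_none t1 s1k kj).
Qed.

Lemma trimmed_word s : trimmed s -> exists w : seq Sigma, s =1 onth w.
Proof.
move=> ts; have [_ [K sK]] := ts.
have exn : exists n, s n == None by exists K; rewrite sK.
case: (ex_minnP exn) => n /eqP sn min_n.
exists (mkseq (fun k => odflt p (s k)) n) => k.
have [kn|nk] := ltnP k n; last first.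
  by rewrite (trimmed_none ts sn nk) onth_default // size_mkseq.
rewrite onthE (nth_map p) ?size_mkseq // nth_mkseq //.
by case sk: (s k) => [//|]; have := min_n k; rewrite sk leqNgt kn => /(_ isT).
Qed.

Lemma bits_word (b : nat -> bool) : (exists K, forall k, K <= k -> b k = false) ->
  exists w : seq Sigma, trimmed (onth w) /\ bits (onth w) =1 b.
Proof.
move=> [K bK].
have exn : exists n, `[< forall k, n <= k -> b k = false >].
  by exists K; apply/asboolP.
case: (ex_minnP exn) => n /asboolP bn min_n.
exists (mkseq (fun k => if b k then q else p) n).
have wE k : onth (mkseq (fun k => if b k then q else p) n) k =
    if k < n then Some (if b k then q else p) else None.
  case: ltnP => kn; last by rewrite onth_default ?size_mkseq.
  by rewrite onthE (nth_map p) ?size_mkseq // nth_mkseq.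
split; last first.
  move=> k; rewrite /bits wE; case: ltnP => [_|/bn->] //.
  case: (b k); first by rewrite eqxx.
  by apply/negbTE; apply: contra pq => /eqP[->].
split; last by exists n => k nk; rewrite wE ltnNge nk.
move=> k; rewrite /trimmed_step !wE; case: (ltnP k n) => kn; last first.
  by apply: Or33; rewrite ltnNge (leqW kn).
case bk: (b k); [by apply: Or31|apply: Or32; split=> //].
(* A final bit 0 would contradict the minimality of [n]. *)
case: ltnP => // nk; have /eqP nE : n == k.+1 by rewrite eqn_leq nk kn.
have : n <= k; last by rewrite leqNgt kn.
apply: min_n; apply/asboolP => j; rewrite leq_eqVlt => /orP[/eqP<- //|].
by rewrite -nE => /bn.
Qed.

End BinaryWords.

(** With at most one letter all words would commute, but [lamp_a * lamp_t] and [lamp_t * lamp_a]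
    differ at lamp 0. *)
Lemma two_letters (A : {fset lamplighter}) : generates A ->
  exists p q : sym_gen A, p <> q.
Proof.
move=> genA; apply: contrapT => no_pq.
have all_eq (s s' : sym_gen A) : s = s'.
  by apply: contrapT => ss'; apply: no_pq; exists s, s'.
have comm (x y : lamplighter) : (x * y = y * x)%g.
  have [[u <-] [v <-]] := (genA x, genA y); rewrite -!word_val_cat.
  case: u => [|s u]; first by rewrite cats0.
  by congr word_val; apply: (@eq_from_nth _ s) => [|i _]; rewrite ?size_cat 1?addnC.
have := congr1 (fun x : lamplighter => x.1 0%R) (comm lamp_a lamp_t).
by rewrite !wreath_mulE !lamp_aE !fsfun0E add0r addr0.
Qed.

(** * The representation and its deviation *)

Section LampRep.
Variables (A : {fset lamplighter}) (p q : sym_gen A).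
Hypothesis pq : p <> q.

(** Pairing twice groups four consecutive bits into one cell. *)
Definition word_cells (s : nat -> option (sym_gen A)) : nat -> cell :=
  pairs (pairs (bits q s)).

Lemma word_cells_inj u v : trimmed p q (onth u) -> trimmed p q (onth v) ->
  word_cells (onth u) =1 word_cells (onth v) -> u = v.
Proof.
move=> tu tv /pairs_inj/pairs_inj uv; apply: eq_from_onth.
exact (trimmed_inj pq tu tv uv).
Qed.

Lemma word_cells_surj x : exists w,
  trimmed p q (onth w) /\ word_cells (onth w) =1 lamp_code x.
Proof.
have [K xK] := lamp_code_blank x.
have [|w [tw wx]] := @bits_word _ p q pq (unpairs (unpairs (lamp_code x))).
  exists (4 * K) => k Kk; rewrite /unpairs xK; first by do 2!case: ifP.
  by rewrite -!divn2 !leq_divRL //; lia.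
exists w; split=> // k; have <- := unpairsK (lamp_code x) k.
rewrite /word_cells /pairs !wx.
by rewrite -[unpairs _ k.*2]unpairsK -[unpairs _ k.*2.+1]unpairsK.
Qed.

Definition lamp_lang : set (seq (sym_gen A)) :=
  [set w | trimmed p q (onth w) /\
           exists x, word_cells (onth w) =1 lamp_code x]%classic.

Definition lamp_map (w : seq (sym_gen A)) : lamplighter :=
  xget 1%g [set x | word_cells (onth w) =1 lamp_code x]%classic.

Lemma lamp_mapE w x : word_cells (onth w) =1 lamp_code x -> lamp_map w = x.
Proof.
move=> wx; rewrite /lamp_map; case: xgetP => [y -> /= wy|/(_ x)//].
by apply: lamp_code_inj => k; rewrite -wx -wy.
Qed.

Lemma lamp_langP w : lamp_lang w <->
  trimmed p q (onth w) /\ word_cells (onth w) =1 lamp_code (lamp_map w).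
Proof.
split=> [[tw [x wx]]|[tw wx]]; first by rewrite (lamp_mapE wx).
by split=> //; exists (lamp_map w).
Qed.

Lemma sofic_trimmed : sofic (trimmed p q).
Proof.
apply: eq_sofic (sofic_local (fun=> True) (trimmed_step p q) (fun o => o = None)).
by move=> s; split=> [[_ sS sF]|[sS sF]].
Qed.

Lemma sofic_word_cells (P : (nat -> cell) -> Prop) :
  sofic P -> sofic (fun s => P (word_cells s)).
Proof.
by move=> /sofic_pairs/sofic_pairs/(@sofic_preim _ _ (fun o => o == Some q)).
Qed.

(** [zip2] transposes a pair of pairs, so that the two tracks are grouped in parallel. *)
Lemma sofic_word_cells2 (P : (nat -> cell * cell) -> Prop) : sofic P ->
  sofic (fun s : nat -> option (sym_gen A) * option (sym_gen A) =>
    P (fun k => (word_cells (fst \o s) k, word_cells (snd \o s) k))).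
Proof.
pose zip2 (X Y : Type) (o : (X * Y) * (X * Y)) := ((o.1.1, o.2.1), (o.1.2, o.2.2)).
move=> /(@sofic_preim _ _ (@zip2 _ _))/sofic_pairs/(@sofic_preim _ _ (@zip2 _ _)).
move=> /sofic_pairs/(@sofic_preim _ _ (fun o => (o.1 == Some q, o.2 == Some q))).
exact.
Qed.

Lemma regular_lamp_lang : regular lamp_lang.
Proof.
exact: (regular_sofic (sofic_and sofic_trimmed (sofic_word_cells sofic_lamp_code))).
Qed.

Lemma lamp_map_bij : set_bij lamp_lang [set: lamplighter] lamp_map.
Proof.
split=> // [u v|x _].
  rewrite !inE => /lamp_langP[tu uE] /lamp_langP[tv vE] uv.
  by apply: word_cells_inj => // k; rewrite uE vE uv.
have [w [tw wx]] := word_cells_surj x.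
by exists w; [split=> //; exists x|apply: lamp_mapE].
Qed.

(** The relation pulls back [lamp_step a] to pairs of trimmed sequences, and trimmed sequences come
    from words. *)
Lemma lamp_automatic a : regular_rel (fun u v => exists g,
  [/\ lamp_lang u, lamp_lang v, lamp_map u = g & lamp_map v = (g * a)%g]).
Proof.
apply: regular_rel_sofic.
apply: eq_sofic (sofic_and (sofic_preim fst sofic_trimmed)
  (sofic_and (sofic_preim snd sofic_trimmed)
    (sofic_word_cells2 (sofic_lamp_step a)))) => s; split.
  move=> [t1 [t2 [x xE]]];
  have [[u uE] [v vE]] := (trimmed_word t1, trimmed_word t2).
  have uE' : fst \o s = onth u by apply/funext.
  have vE' : snd \o s = onth v by apply/funext.
  rewrite uE' in t1 xE; rewrite vE' in t2 xE.
  have ux : word_cells (onth u) =1 lamp_code x.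
    move=> k; exact (congr1 fst (xE k)).
  have vx : word_cells (onth v) =1 lamp_code (x * a)%g.
    move=> k; exact (congr1 snd (xE k)).
  exists u, v; split.
    exists x; rewrite (lamp_mapE ux) (lamp_mapE vx); split=> //.
      by split=> //; exists x.
    by split=> //; exists (x * a)%g.
  by move=> k; rewrite -uE -vE /= -surjective_pairing.
move=> [u [v [[x [/lamp_langP[tu uE] /lamp_langP[tv vE] ux vx]] sE]]].
have -> : s = (fun k => (onth u k, onth v k)) by apply/funext.
by do 2![split=> //]; exists x => k; rewrite -vx -ux -uE -vE.
Qed.

Definition lamp_rep : cayley_rep A :=
  @CayleyRep _ A lamp_lang lamp_map regular_lamp_lang lamp_map_bij
    (fun a _ => lamp_automatic a).

Lemma lamp_rep_within w : lamp_lang w -> lamp_within (size w) (lamp_map w).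
Proof.
case/lamp_langP=> _ wE.
have blank k : size w <= k -> lamp_code (lamp_map w) k = blank_cell.
  move=> wk; rewrite -wE /word_cells /pairs /bits.
  by rewrite !onth_default //; apply: leq_trans wk _; rewrite -!muln2; lia.
split=> [[k|k]|].
(* Cells from index [size w] on are blank. [Posz k] has absolute value [k] but [Negz k] has [k + 1],
   so only the nonnegative side has slack. *)
- rewrite leqNgt; apply: contra => wk.
  by have [_ _ /negbFE-> _] := blank k (ltnW wk).
- rewrite leqNgt; apply: contra => wk.
  by have [_ _ _ /negbFE->] := blank k wk.
case x2 : ((lamp_map w).2 : int) => [k|k].
  rewrite leqNgt; apply/negP => wk; have [+ _ _ _] := blank k (ltnW wk).
  by rewrite x2 eqxx.
rewrite leqNgt; apply/negP => wk; have [_ + _ _] := blank k wk.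
by rewrite x2 eqxx.
Qed.

(** Triangle inequality through 1: [word_val w] and [lamp_map w] both have word length linear in
    [n]. *)
Lemma deviation_lamp_rep : generates A ->
  exists K, forall n, deviation lamp_rep n <= K * n.+1.
Proof.
move=> genA; have [wa waE] := genA lamp_a; have [wt wtE] := genA lamp_t.
pose e := size wa + size wt.
have ea : ball A e lamp_a.
  by rewrite -waE; apply: ball_leq (ball_word wa); apply: leq_addr.
have et : ball A e lamp_t.
  by rewrite -wtE; apply: ball_leq (ball_word wt); apply: leq_addl.
exists (7 * e).+1 => n; apply: deviation_leq => // w Lw wn.
have wn_in := lamp_within_leq wn (lamp_rep_within Lw).
have := ballM (ballV (ball_leq wn (ball_word w))) (ball_lamp_within ea et wn_in).
by apply: ball_leq; rewrite [leqRHS]mulSn leq_add2r.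
Qed.

End LampRep.

(** * From deviation bounds to the growth order *)

Theorem theorem15 (R : realType) (A : {fset lamplighter}) (genA : generates A) :
  in_class_B A (growth_id R) /\
  (forall f : growth R, prec f (growth_id R) -> ~ in_class_B A f).
Proof.
split.
  have [p [q pq]] := two_letters genA; have [K dK] := deviation_lamp_rep pq genA.
  (* For [n >= 1], [K * (n + 1) <= 2 * K * n]; the successor makes the constant positive. *)
  exists (lamp_rep pq), (2 * K).+1, 1, (deviation_start (lamp_rep pq)).
  split=> // [|n n_start|n n_start] /=; first exact: deviation_start_gt0.
    by split=> //; apply: leq_trans n_start; apply: deviation_start_gt0.
  rewrite mul1n -natrM ler_nat (leq_trans (dK n)) //.
  by have := leq_trans (deviation_start_gt0 _) n_start; nia.
move=> f [f_le_id id_nle_f] [psi [K [M [N [K0 M0 N0 dom dev_f]]]]].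
apply: id_nle_f; split=> //; have [C devC] := deviation_lower psi genA.
(* [c] absorbs both additive constants: [C * n + C <= c * n], and [n >= c] will turn
   [n <= C * (d + 1)] into [n <= c * d]. *)
pose c := C.*2.+1; exists (c * K), (M * c), (N + c).
split=> [|||n|n] //; rewrite ?muln_gt0 ?addn_gt0 ?K0 ?M0 ?N0 //.
  move=> Nn; have /dom[_ f_n] : N <= n by apply: leq_trans Nn; apply: leq_addr.
  by split=> //; apply: leq_trans Nn; rewrite addn_gt0 N0.
move=> Nn /=; have cn : N <= c * n by nia.
have : n <= c * deviation psi (c * n).
  have := devC n.
  have dev_c : deviation psi (C * n + C) <= deviation psi (c * n).
    by apply: deviation_homo; rewrite /c -addnn; nia.
  move=> nC; have : n <= C * (deviation psi (c * n)).+1.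
    by apply: leq_trans nC _; rewrite leq_mul2l ltnS dev_c orbT.
  by move: Nn; rewrite /c -addnn; nia.
rewrite -(ler_nat R) => /le_trans; apply; rewrite natrM.
by rewrite (natrM _ c K) -mulrA ler_wpM2l // (le_trans (dev_f _ cn)) // mulnA.
Qed.
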